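(* Let $n\geq1$ be an integer and let $p>1$. Let $U=(u,v,0)$ be a horizontal vector in $\mathbb{H}^n$ (with $u,v\in\mathbb{R}^n$) and let $t\in\mathbb{R}$. Then the right-translation $\widehat{T}_{tU}:\mathbb{H}^n\to\mathbb{H}^n$ defined by $$\widehat{T}_{tU}(x,y,z)=(x,y,z)\ast(tU),\qquad (x,y,z)\in\mathbb{H}^n,$$ where $tU=(tu,tv,0)$, is an optimal transport map between any $\nu\in\mathcal{W}_p(\mathbb{H}^n)$ and its image $(\widehat{T}_{tU})_{\#}\nu$. Moreover, a curve $\gamma:\mathbb{R}\to\mathcal{W}_p(\mathbb{H}^n)$ is a complete geodesic if and only if there exist $\mu\in\mathcal{W}_p(\mathbb{H}^n)$ and a non-zero horizontal vector $U=(u,v,0)$ such that $\gamma(t)=(\widehat{T}_{tU})_{\#}\mu$ for all $t\in\mathbb{R}$.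
   Context: Heisenberg group: $\mathbb{H}^n=\mathbb{R}^n\times\mathbb{R}^n\times\mathbb{R}$ with the group operation $(x,y,z)\ast(x',y',z')=\big(x+x',\,y+y',\,z+z'+2\sum_{i=1}^n(x'_iy_i-x_iy'_i)\big)$. It is endowed with the left-invariant Heisenberg-Korányi metric $d_H((x,y,z),(x',y',z'))=\|(-x,-y,-z)\ast(x',y',z')\|_H$, where $\|(x,y,z)\|_H=\Big(\big(\sum_{i=1}^n(x_i^2+y_i^2)\big)^2+z^2\Big)^{1/4}$. Horizontal vectors are the elements of the form $(x,y,0)\in\mathbb{H}^n$. Wasserstein space: for a complete separable metric space $(X,\varrho)$ and $p\geq1$, $\mathcal{W}_p(X)$ is the set of Borel probability measures $\mu$ on $X$ with $\int_X\varrho^p(x,\hat x)\,\mathrm{d}\mu(x)<\infty$ for some (hence all) $\hat x\in X$, endowed with the distance $d_{\mathcal{W}_p}(\mu,\nu)=\Big(\inf_{\Pi\in C(\mu,\nu)}\iint_{X\times X}\varrho^p(x,y)\,\mathrm{d}\Pi(x,y)\Big)^{1/p}$, where $C(\mu,\nu)$ is the set of couplings, i.e. Borel probability measures on $X\times X$ with marginals $\mu$ and $\nu$. Here $X=\mathbb{H}^n$ and $\varrho=d_H$. A coupling attaining the infimum is called optimal. Push-forward: $(f_{\#}\mu)(A)=\mu(f^{-1}[A])$ for Borel sets $A$. A Borel map $T:\mathbb{H}^n\to\mathbb{H}^n$ is an optimal transport map between $\nu$ and $T_{\#}\nu$ if the coupling $(\mathrm{Id}\times T)_{\#}\nu$,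 with $(\mathrm{Id}\times T)(q)=(q,T(q))$, is optimal. A complete geodesic is a curve $\gamma:\mathbb{R}\to\mathcal{W}_p(\mathbb{H}^n)$ for which there is a constant $C>0$ such that $d_{\mathcal{W}_p}(\gamma(t),\gamma(s))=C|t-s|$ for all $t,s\in\mathbb{R}$. *)

(* Defs.v *)
From HB Require Import structures.
From mathcomp Require Import all_boot all_order all_algebra.
From mathcomp Require Import all_classical all_reals all_analysis.
From mathcomp Require Import ring lra.

Set Implicit Arguments.
Unset Strict Implicit.
Unset Printing Implicit Defensive.

Import Order.TTheory GRing.Theory Num.Theory.
Import numFieldNormedType.Exports.

Local Open Scope classical_set_scope.
Local Open Scope ring_scope.

#[short(type="pointedMetricType")]
HB.structure Definition PointedMetric (K : numDomainType) :=
  {M of Metric K M & Pointed M}.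

Definition borel (R : realType) (X : pointedMetricType R) :=
  g_sigma_algebraType (@open X).

(* A measure is a function on all sets of points, whose values on
   non-measurable sets are meaningless: equality of measures has to be
   restricted to measurable sets. *)
Definition eq_meas d (T : measurableType d) (R : realType)
    (mu nu : set T -> \bar R) : Prop :=
  forall A, measurable A -> mu A = nu A.

Section Wasserstein.
Context {R : realType} {X : pointedMetricType R}.
Local Open Scope ereal_scope.

Definition finite_moment (p : R) (mu : probability (borel X) R) : Prop :=
  exists x0 : X, \int[mu]_x ((@mdist R X x x0 `^ p)%R)%:E < +oo.

Definition Wp (p : R) : set (probability (borel X) R) :=
  [set mu | finite_moment p mu].

(* The product sigma-algebra on [borel X * borel X] is the Borel one of X * X
   as soon as X is separable. *)
Definition coupling (mu nu : probability (borel X) R) :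
    set (probability (borel X * borel X)%type R) :=
  [set Pi | eq_meas (pushforward Pi fst) mu /\ eq_meas (pushforward Pi snd) nu].

Definition cost (p : R) (Pi : probability (borel X * borel X)%type R) : \bar R :=
  \int[Pi]_q ((@mdist R X q.1 q.2 `^ p)%R)%:E.

Definition optimal_cost (p : R) (mu nu : probability (borel X) R) : \bar R :=
  ereal_inf [set cost p Pi | Pi in coupling mu nu].

Definition dWp (p : R) (mu nu : probability (borel X) R) : \bar R :=
  poweR (optimal_cost p mu nu) (p^-1)%R.

Definition optimal_coupling (p : R) (mu nu : probability (borel X) R)
    (Pi : probability (borel X * borel X)%type R) : Prop :=
  coupling mu nu Pi /\ cost p Pi = optimal_cost p mu nu.

Definition graph_fun (T : borel X -> borel X) (q : borel X) :
  (borel X * borel X)%type := (q, T q).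

Lemma measurable_graph_fun (T : {mfun borel X >-> borel X}) :
  measurable_fun [set: borel X] (graph_fun T).
Proof. by apply: measurable_fun_pair. Qed.

HB.instance Definition _ (T : {mfun borel X >-> borel X}) :=
  isMeasurableFun.Build _ _ _ _ (graph_fun T) (measurable_graph_fun T).

(* [distribution nu T] is the push-forward of nu by the Borel map T. *)
Definition optimal_transport_map (p : R) (nu : probability (borel X) R)
    (T : {mfun borel X >-> borel X}) : Prop :=
  optimal_coupling p nu (distribution nu T) (distribution nu (graph_fun T)).

Definition complete_geodesic (p : R) (gamma : R -> probability (borel X) R) :
    Prop :=
  (forall t, Wp p (gamma t)) /\
  exists2 C : R, (0 < C)%R &
    forall t s, dWp p (gamma t) (gamma s) = (C * `|t - s|)%:E.

End Wasserstein.

(* A record rather than a product type, so that the only metric and topology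
   on it are those given by [heis_dist] below. *)
Record heis (R : realType) (n : nat) :=
  Heis { hx : 'rV[R]_n ; hy : 'rV[R]_n ; hz : R }.

Section Heisenberg.
Context {R : realType} {n : nat}.
Local Notation H := (heis R n).
Implicit Types q a b c : H.

Definition heis_pack q := (hx q, hy q, hz q).
Definition heis_unpack (w : 'rV[R]_n * 'rV[R]_n * R) := Heis w.1.1 w.1.2 w.2.
Lemma heis_packK : cancel heis_pack heis_unpack. Proof. by case. Qed.

HB.instance Definition _ := Choice.copy H (can_type heis_packK).
HB.instance Definition _ := isPointed.Build H (Heis 0 0 0).

Definition heis_mul q q' : H :=
  Heis (hx q + hx q') (hy q + hy q')
    (hz q + hz q' +
     2 * \sum_(i < n) (hx q' 0 i * hy q 0 i - hx q 0 i * hy q' 0 i)).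

Definition heis_opp q : H := Heis (- hx q) (- hy q) (- hz q).

Definition heis_norm q : R :=
  ((\sum_(i < n) (hx q 0 i ^+ 2 + hy q 0 i ^+ 2)) ^+ 2 + hz q ^+ 2) `^ 4^-1.

Definition heis_dist q q' : R := heis_norm (heis_mul (heis_opp q) q').

Let P q := \sum_(i < n) (hx q 0 i ^+ 2 + hy q 0 i ^+ 2).
Let S q q' := \sum_(i < n) (hx q 0 i * hx q' 0 i + hy q 0 i * hy q' 0 i).
Let W q q' := \sum_(i < n) (hx q' 0 i * hy q 0 i - hx q 0 i * hy q' 0 i).

Let P_ge0 q : 0 <= P q.
Proof. by apply: sumr_ge0 => i _; rewrite addr_ge0 ?sqr_ge0. Qed.

Let norm_ge0 q : 0 <= heis_norm q. Proof. exact: powR_ge0. Qed.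

Let norm4 q : heis_norm q ^+ 4 = P q ^+ 2 + hz q ^+ 2.
Proof.
rewrite -powR_mulrn ?norm_ge0// /heis_norm -powRrM mulVf ?pnatr_eq0//.
by rewrite powRr1// addr_ge0 ?sqr_ge0.
Qed.

Let PS q q' : P (heis_mul q q') = P q + P q' + 2 * S q q'.
Proof.
rewrite /P /S mulr_sumr -!big_split/=; apply: eq_bigr => i _.
by rewrite !mxE; ring.
Qed.

Let cauchy_schwarz q q' : S q q' ^+ 2 + W q q' ^+ 2 <= P q * P q'.
Proof.
have sq l s w : 0 <= l ^+ 2 * P q + (s ^+ 2 + w ^+ 2) * P q'
                 + (- 2 * l * s) * S q q' + (- 2 * l * w) * W q q'.
  rewrite /P /S /W !mulr_sumr -!big_split/=; apply: sumr_ge0 => i _.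
  move: (hx q 0 i) (hy q 0 i) (hx q' 0 i) (hy q' 0 i) => x y x' y'.
  rewrite [X in 0 <= X](_ : _ = (l * x - (s * x' - w * y')) ^+ 2
                     + (l * y - (s * y' + w * x')) ^+ 2); last by ring.
  by rewrite addr_ge0 ?sqr_ge0.
have key l : 0 <= l ^+ 2 * P q + (S q q' ^+ 2 + W q q' ^+ 2) * P q'
                 - 2 * l * (S q q' ^+ 2 + W q q' ^+ 2).
  have := sq l (S q q') (W q q').
  by congr (0 <= _); ring.
have c_ge0 : 0 <= S q q' ^+ 2 + W q q' ^+ 2 by rewrite addr_ge0 ?sqr_ge0.
move: (P_ge0 q) (P_ge0 q') c_ge0 key.
move: (S q q' ^+ 2 + W q q' ^+ 2) (P q) (P q') => c A B A0 B0 c0 key.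
have [A00|A00] := eqVneq A 0.
  have := key (B + 1); rewrite A00 mulr0 add0r mul0r => h.
  have : 0 <= c * B by rewrite mulr_ge0.
  by nra.
have Agt0 : 0 < A by rewrite lt_neqAle eq_sym A00.
have := key (c / A).
rewrite (_ : _ - _ = c * (A * B - c) / A); last by field.
rewrite pmulr_lge0 ?invr_gt0// => h.
rewrite leNgt; apply/negP => h'.
have c1 : 0 < c by apply: le_lt_trans h'; rewrite mulr_ge0.
by move: h; rewrite pmulr_rge0// subr_ge0 leNgt h'.
Qed.

Let minkowski (a1 a2 b1 b2 c1 c2 N M : R) : 0 <= N -> 0 <= M ->
  a1 ^+ 2 + a2 ^+ 2 <= N ^+ 4 -> b1 ^+ 2 + b2 ^+ 2 <= M ^+ 4 ->
  c1 ^+ 2 + c2 ^+ 2 <= N ^+ 2 * M ^+ 2 ->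
  (a1 + b1 + 2 * c1) ^+ 2 + (a2 + b2 + 2 * c2) ^+ 2 <= (N + M) ^+ 4.
Proof.
have dot (u1 u2 v1 v2 k l : R) : 0 <= k -> 0 <= l ->
    u1 ^+ 2 + u2 ^+ 2 <= k ^+ 2 -> v1 ^+ 2 + v2 ^+ 2 <= l ^+ 2 ->
    u1 * v1 + u2 * v2 <= k * l.
  move=> k0 l0 hu hv; apply: le_trans (ler_norm _) _.
  rewrite -(@ler_pXn2r _ 2)// ?nnegrE ?mulr_ge0// real_normK ?num_real//.
  rewrite exprMn; apply: le_trans (ler_pM _ _ hu hv); rewrite ?addr_ge0 ?sqr_ge0//.
  rewrite -subr_ge0 (_ : _ - _ = (u1 * v2 - u2 * v1) ^+ 2) ?sqr_ge0//.
  by ring.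
move=> N0 M0 hN hM hc.
have ab : a1 * b1 + a2 * b2 <= N ^+ 2 * M ^+ 2.
  by apply: dot; rewrite ?exprn_ge0// -exprM.
have ac : a1 * c1 + a2 * c2 <= N ^+ 2 * (N * M).
  by apply: dot; rewrite ?exprn_ge0 ?mulr_ge0// -?exprM// exprMn.
have bc : b1 * c1 + b2 * c2 <= M ^+ 2 * (N * M).
  by apply: dot; rewrite ?exprn_ge0 ?mulr_ge0// -?exprM// exprMn.
rewrite (_ : (N + M) ^+ 4 = N ^+ 4 + M ^+ 4 + 4 * (N ^+ 2 * M ^+ 2)
   + 2 * (N ^+ 2 * M ^+ 2) + 4 * (N ^+ 2 * (N * M)) + 4 * (M ^+ 2 * (N * M)));
  last by ring.
rewrite (_ : _ + _ = (a1 ^+ 2 + a2 ^+ 2) + (b1 ^+ 2 + b2 ^+ 2)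
   + 4 * (c1 ^+ 2 + c2 ^+ 2) + 2 * (a1 * b1 + a2 * b2)
   + 4 * (a1 * c1 + a2 * c2) + 4 * (b1 * c1 + b2 * c2)); last by ring.
lra.
Qed.

Let norm_mul q q' : heis_norm (heis_mul q q') <= heis_norm q + heis_norm q'.
Proof.
have P2 a : P a <= heis_norm a ^+ 2.
  rewrite -(@ler_pXn2r _ 2)// ?nnegrE ?exprn_ge0// -exprM norm4 lerDl.
  exact: sqr_ge0.
rewrite -(@ler_pXn2r _ 4)// ?nnegrE ?addr_ge0// norm4 PS.
apply: (@minkowski _ _ _ _ _ (W q q')); rewrite ?norm4//.
apply: le_trans (cauchy_schwarz _ _) _.
by apply: ler_pM.
Qed.

Let dist_split a b c : heis_mul (heis_opp a) c =
  heis_mul (heis_mul (heis_opp a) b) (heis_mul (heis_opp b) c).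
Proof.
rewrite /heis_mul/=; congr Heis; [by rewrite addrA addrK..|].
rewrite [RHS](_ : _ = - hz a + hz c + 2 * (
    \sum_(i < n) (hx b 0 i * (- hy a) 0 i - (- hx a) 0 i * hy b 0 i) +
    \sum_(i < n) (hx c 0 i * (- hy b) 0 i - (- hx b) 0 i * hy c 0 i) +
    \sum_(i < n) ((- hx b + hx c) 0 i * (- hy a + hy b) 0 i
       - (- hx a + hx b) 0 i * (- hy b + hy c) 0 i))); last by ring.
congr (_ + 2 * _); rewrite -!big_split/=; apply: eq_bigr => i _.
by rewrite !mxE; ring.
Qed.

Let heis_distxx q : heis_dist q q = 0.
Proof.
suff : heis_dist q q ^+ 4 == 0 by rewrite expf_eq0/= => /eqP.
rewrite /heis_dist norm4 /P big1 => [|i _]; last by rewrite !mxE; ring.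
rewrite /= big1 => [|i _]; last by rewrite !mxE; ring.
by rewrite addNr mulr0 addr0 expr0n addr0.
Qed.

Let heis_dist_positivity a b : heis_dist a b = 0 -> a = b.
Proof.
move=> d0; have : heis_dist a b ^+ 4 = 0 by rewrite d0 expr0n.
rewrite /heis_dist norm4 => /eqP; rewrite paddr_eq0 ?sqr_ge0//.
rewrite !expf_eq0/= => /andP[/eqP P0 z0].
have h i : a.(hx) 0 i = b.(hx) 0 i /\ a.(hy) 0 i = b.(hy) 0 i.
  have := psumr_eq0P _ P0; move=> /(_ (fun i _ => addr_ge0 (sqr_ge0 _) (sqr_ge0 _))).
  move=> /(_ i isT)/eqP; rewrite paddr_eq0 ?sqr_ge0// !expf_eq0/= !mxE.
  by rewrite ![- _ + _]addrC !subr_eq0 => /andP[/eqP -> /eqP ->].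
have ex : hx a = hx b by apply/rowP => i; case: (h i).
have ey : hy a = hy b by apply/rowP => i; case: (h i).
move: z0; rewrite /= ex ey big1 => [|i _]; last by rewrite !mxE; ring.
rewrite mulr0 addr0 addrC subr_eq0 => /eqP ez.
by case: a b ex ey ez {d0 P0 h} => [x y z] [x' y' z'] /= -> -> ->.
Qed.

Let heis_dist_sym a b : heis_dist a b = heis_dist b a.
Proof.
rewrite /heis_dist /heis_norm; congr ((_ ^+ 2 + _) `^ _).
  by apply: eq_bigr => i _; rewrite !mxE; ring.
rewrite -[LHS]sqrrN; congr (_ ^+ 2) => /=; rewrite 2!opprD opprK [hz a - _]addrC.
rewrite -mulrN -sumrN; congr (_ + 2 * _).
by apply: eq_bigr => i _; rewrite !mxE; ring.
Qed.

Let heis_dist_triangle b a c : heis_dist a c <= heis_dist a b + heis_dist b c.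
Proof. by rewrite /heis_dist (dist_split a b c). Qed.

HB.instance Definition _ := isMetric.Build R H
  heis_distxx heis_dist_positivity heis_dist_sym heis_dist_triangle.

Lemma heis_mdistE a b : mdist a b = heis_dist a b. Proof. by []. Qed.

Definition horizontal (u v : 'rV[R]_n) : H := Heis u v 0.

Definition right_translation (a : H) (q : borel H) : borel H := heis_mul q a.

Let conj_norm a b U : heis_dist (heis_mul a U) (heis_mul b U) ^+ 4 =
  let g := heis_mul (heis_opp a) b in P g ^+ 2 + (hz g + 4 * W g U) ^+ 2.
Proof.
rewrite /heis_dist norm4 /=; congr (_ ^+ 2 + _ ^+ 2).
  by apply: eq_bigr => i _; rewrite !mxE; ring.
rewrite /W /=.
rewrite [RHS](_ : _ = - hz a + hz b + 2 * (
    \sum_(i < n) (hx b 0 i * (- hy a) 0 i - (- hx a) 0 i * hy b 0 i) +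
    2 * \sum_(i < n) (hx U 0 i * (- hy a + hy b) 0 i
       - (- hx a + hx b) 0 i * hy U 0 i))); last by ring.
rewrite [LHS](_ : _ = - hz a + hz b + 2 * (
    - \sum_(i < n) (hx U 0 i * hy a 0 i - hx a 0 i * hy U 0 i) +
    \sum_(i < n) (hx U 0 i * hy b 0 i - hx b 0 i * hy U 0 i) +
    \sum_(i < n) ((hx b + hx U) 0 i * (- (hy a + hy U)) 0 i
       - (- (hx a + hx U)) 0 i * (hy b + hy U) 0 i))); last by ring.
congr (_ + 2 * _).
rewrite mulr_sumr -sumrN -!big_split/=; apply: eq_bigr => i _.
by rewrite !mxE; ring.
Qed.

Lemma continuous_right_translation a : continuous (fun q : H => heis_mul q a).
Proof.
move=> q B /nbhs_ballP[e /= e0 eB].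
pose u := Num.sqrt (P a).
have u0 : 0 <= u by exact: sqrtr_ge0.
have uE : u ^+ 2 = P a by rewrite sqr_sqrtr.
pose d := Num.min 1 (e ^+ 2 / (2 + 4 * u)).
have d0 : 0 < d by rewrite lt_min ltr01 divr_gt0 ?exprn_gt0//; lra.
have d1 : d <= 1 by rewrite ge_min lexx.
have de : d * (2 + 4 * u) <= e ^+ 2.
  by rewrite -ler_pdivlMr ?ge_min ?lexx ?orbT//; lra.
apply/nbhs_ballP; exists d => //= q'.
rewrite ballEmdist/= => qq'; apply: eB; rewrite ballEmdist/=.
have e4 : mdist (heis_mul q a) (heis_mul q' a) ^+ 4 < e ^+ 4.
  rewrite heis_mdistE conj_norm/=; set g := heis_mul _ _.
  have gd : heis_norm g ^+ 4 < d ^+ 4 by rewrite ltr_pXn2r ?nnegrE ?norm_ge0 ?(ltW d0).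
  move: gd; rewrite norm4 => gd.
  have gP := P_ge0 g.
  have d2 : 0 <= d ^+ 2 by exact: sqr_ge0.
  have Pd : P g <= d ^+ 2.
    by rewrite -(@ler_pXn2r _ 2)// ?nnegrE// -exprM; nra.
  have zd : `|hz g| <= d ^+ 2.
    rewrite -(@ler_pXn2r _ 2)// ?nnegrE// -exprM real_normK ?num_real//.
    by nra.
  have Wd : `|W g a| <= d * u.
    rewrite -(@ler_pXn2r _ 2)// ?nnegrE ?mulr_ge0// ?(ltW d0)//.
    rewrite real_normK ?num_real// exprMn uE.
    apply: (@le_trans _ _ (P g * P a)); last exact: ler_wpM2r.
    by apply: le_trans (cauchy_schwarz _ _); rewrite lerDr sqr_ge0.
  have dd : d ^+ 2 <= d by rewrite expr2 ler_piMl// ltW.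
  have zW : `|hz g + 4 * W g a| <= d * (1 + 4 * u).
    apply: le_trans (ler_normD _ _) _; rewrite normrM ger0_norm//; lra.
  have zW2 : (hz g + 4 * W g a) ^+ 2 <= (d * (1 + 4 * u)) ^+ 2.
    rewrite -real_normK ?num_real// ler_pXn2r// nnegrE//.
    by rewrite mulr_ge0//; lra.
  have P2 : P g ^+ 2 <= d ^+ 2.
    by rewrite ler_pXn2r// ?nnegrE; lra.
  have e24 : (d * (2 + 4 * u)) ^+ 2 <= e ^+ 4.
    rewrite (exprM e 2 2) ler_pXn2r// nnegrE ?sqr_ge0//.
    by rewrite mulr_ge0//; lra.
  apply: lt_le_trans e24.
  have dd0 : 0 < d ^+ 2 by rewrite exprn_gt0.
  have ddu : 0 <= d ^+ 2 * u by rewrite mulr_ge0.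
  apply: (@le_lt_trans _ _ (d ^+ 2 + (d * (1 + 4 * u)) ^+ 2)).
    exact: lerD P2 zW2.
  rewrite [ltRHS](_ : _ = (d * (1 + 4 * u)) ^+ 2 + d ^+ 2 + 2 * d ^+ 2
    + 8 * (d ^+ 2 * u)); last by ring.
  lra.
by move: e4; rewrite ltr_pXn2r// nnegrE ?(ltW e0)//; exact: norm_ge0.
Qed.

Lemma measurable_right_translation a :
  measurable_fun [set: borel H] (right_translation a).
Proof.
apply: (@measurability _ _ (borel H) (borel H) setT
  (right_translation a) (@open H)) => //.
move=> _ [V oV <-]; rewrite setTI; apply: sub_sigma_algebra.
by have /continuousP h := @continuous_right_translation a; exact: h.
Qed.

HB.instance Definition _ a := isMeasurableFun.Build _ _ _ _
  (right_translation a) (measurable_right_translation a).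

End Heisenberg.

(* Main.v *)
Require Import Defs.
From HB Require Import structures.
From mathcomp Require Import all_boot all_order all_algebra.
From mathcomp Require Import all_classical all_reals all_analysis.
From mathcomp Require Import measurable_realfun.
From mathcomp Require Import ring lra.

(** Let [pi] be the projection of the Heisenberg group onto the horizontal
    coordinates. It is 1-Lipschitz, so by Jensen's inequality the cost of any
    coupling of [mu] and [nu] is at least the [p]-th power of the distance of the
    means of [pi] under [mu] and [nu] ([optimal_cost_ge]). A translation by a
    horizontal vector moves all points, and the mean, by the length of this
    vector: it attains the bound, hence is optimal, and the orbits of these
    translations are geodesics ([optimal_cost_translate]).

    Conversely, let [gamma] be a complete geodesic of speed [C], and [m t] the
    mean of [pi] under [gamma t]. The point is that [m] moves at speed [C]. The
    Koranyi metric is strictly convex in the horizontal directions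
    ([triangle_excess]), which gives a [defect] for three points: it is small in
    norm if the two consecutive distances and the total distance have almost the
    norms that they have along the geodesic ([lpnorm_defect_small]). This is used
    twice.
    - Gluing near-optimal couplings of [gamma s], [gamma (s + tau)] and
      [gamma (s + 2 tau)] shows that [m] takes equally spaced values
      ([hmean_midpoint]). Disintegration is replaced by conditioning on the cells
      of a fine countable partition ([partition_gluing]).
    - For large [T], couple the pair [(gamma (s - T), gamma s)] independently of
      the pair [(gamma s, gamma (s + T))]. The total distance is still at least
      [2 C T] in norm, and the mismatch at time [s] is bounded, so the defect is
      [o(T)]. Hence the forward displacement almost equals the backward one,
      which is independent of it: both are almost deterministic, and [m] moves
      at almost full speed over long times ([hmean_growth]).

    Since the spacing is constant, the speed of [m] is [C] at every scale
    ([hmean_speed]). Thus there is equality in the lower bound of the cost by the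
    means, which forces near-optimal couplings to concentrate on the graph of
    the translation by [m t - m s] ([translate_of_optimal]), so that [gamma t] is
    the translate of [gamma s]. Finally [m] is an isometric embedding of the line
    into a Euclidean space, so it is affine ([hmean_affine]). *)

Set Implicit Arguments.
Unset Strict Implicit.
Unset Printing Implicit Defensive.

Import Order.TTheory GRing.Theory Num.Theory.
Import numFieldNormedType.Exports.

Local Open Scope classical_set_scope.
Local Open Scope ring_scope.

(** * Euclidean and symplectic vectors *)

Section Euclid.
Context {R : realType} {m : nat}.
Implicit Types u v w : 'rV[R]_m.

Definition dot u v : R := \sum_i u 0 i * v 0 i.

Definition enorm u : R := Num.sqrt (dot u u).

Lemma dotC u v : dot u v = dot v u.
Proof. by apply: eq_bigr => i _; rewrite mulrC. Qed.

Lemma dotDl u v w : dot (u + v) w = dot u w + dot v w.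
Proof. by rewrite -big_split; apply: eq_bigr => i _; rewrite !mxE mulrDl. Qed.

Lemma dotZl a u w : dot (a *: u) w = a * dot u w.
Proof. by rewrite mulr_sumr; apply: eq_bigr => i _; rewrite !mxE mulrA. Qed.

Lemma dotNl u w : dot (- u) w = - dot u w.
Proof. by rewrite -scaleN1r dotZl mulN1r. Qed.

Lemma dotDr u v w : dot w (u + v) = dot w u + dot w v.
Proof. by rewrite !(dotC w) dotDl. Qed.

Lemma dotZr a u w : dot w (a *: u) = a * dot w u.
Proof. by rewrite !(dotC w) dotZl. Qed.

Lemma dotNr u w : dot w (- u) = - dot w u.
Proof. by rewrite !(dotC w) dotNl. Qed.

Definition dotE := (dotDl, dotDr, dotNl, dotNr, dotZl, dotZr).

Lemma dot_ge0 u : 0 <= dot u u.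
Proof. by apply: sumr_ge0 => i _; rewrite -expr2 sqr_ge0. Qed.

Lemma dot_eq0 u : dot u u = 0 -> u = 0.
Proof.
move=> /psumr_eq0P u0; apply/rowP => i; rewrite mxE.
have /eqP : u 0 i * u 0 i = 0 by apply: u0 => // j _; rewrite -expr2 sqr_ge0.
by rewrite mulf_eq0 orbb => /eqP.
Qed.

Lemma enorm_ge0 u : 0 <= enorm u. Proof. exact: sqrtr_ge0. Qed.

Lemma enorm_sq u : enorm u ^+ 2 = dot u u.
Proof. by rewrite sqr_sqrtr ?dot_ge0. Qed.

Lemma enorm0_eq0 u : enorm u = 0 -> u = 0.
Proof. by move=> u0; apply: dot_eq0; rewrite -enorm_sq u0 expr0n. Qed.

Lemma enormZ a u : enorm (a *: u) = `|a| * enorm u.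
Proof.
by rewrite /enorm !dotE mulrA -expr2 sqrtrM ?sqr_ge0// sqrtr_sqr.
Qed.

Lemma enormN u : enorm (- u) = enorm u.
Proof. by rewrite /enorm !dotE opprK. Qed.

Lemma dot_le u v : dot u v <= enorm u * enorm v.
Proof.
have [->|v0] := eqVneq v 0.
  by rewrite -(scale0r 0) dotZr mul0r mulr_ge0 ?enorm_ge0.
have B0 : 0 < dot v v.
  rewrite lt_neqAle dot_ge0 andbT eq_sym; apply: contra_neq v0; exact: dot_eq0.
apply: le_trans (ler_norm _) _.
rewrite -(@ler_pXn2r _ 2)// ?nnegrE ?mulr_ge0 ?enorm_ge0//.
rewrite real_normK ?num_real// exprMn !enorm_sq.
have := dot_ge0 (dot v v *: u - dot u v *: v).
rewrite !dotE (dotC v u).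
rewrite [X in 0 <= X -> _](_ : _ = dot v v * (dot u u * dot v v - dot u v ^+ 2));
  last by ring.
by rewrite pmulr_rge0// subr_ge0.
Qed.

Lemma dot_normr_le u v : `|dot u v| <= enorm u * enorm v.
Proof. by rewrite ler_norml lerNl -dotNl -{1}(enormN u) !dot_le. Qed.

Lemma enormD u v : enorm (u + v) <= enorm u + enorm v.
Proof.
rewrite -(@ler_pXn2r _ 2)// ?nnegrE ?addr_ge0 ?enorm_ge0// enorm_sq !dotE.
rewrite sqrrD !enorm_sq (dotC v u); have := dot_le u v; lra.
Qed.

Lemma enormB u v : enorm (u - v) <= enorm u + enorm v.
Proof. by rewrite -(enormN v) enormD. Qed.

Lemma enormBC u v : enorm (u - v) = enorm (v - u).
Proof. by rewrite -enormN opprB. Qed.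

Lemma enormB_sq u v :
  enorm (u - v) ^+ 2 = enorm u ^+ 2 + enorm v ^+ 2 - 2 * dot u v.
Proof. by rewrite !enorm_sq !dotE (dotC v u); ring. Qed.

End Euclid.

(** The quarter turn of the plane in each pair of coordinates: the symplectic
    form in the group law is [dot u (quarter v)]. *)
Definition quarter {R : realType} {n : nat} (v : 'rV[R]_(n + n)) :
  'rV[R]_(n + n) := row_mx (rsubmx v) (- lsubmx v).

Section Symplectic.
Context {R : realType} {n : nat}.
Implicit Types u v w : 'rV[R]_(n + n).

Lemma dot_row_mx (a b c d : 'rV[R]_n) :
  dot (row_mx a b) (row_mx c d) = dot a c + dot b d.
Proof.
rewrite /dot big_split_ord /=; congr (_ + _); apply: eq_bigr => i _;
  by rewrite ?row_mxEl ?row_mxEr.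
Qed.

Lemma quarterD u v : quarter (u + v) = quarter u + quarter v.
Proof. by rewrite /quarter !linearD/= add_row_mx. Qed.

Lemma quarterN u : quarter (- u) = - quarter u.
Proof. by rewrite /quarter !linearN/= opp_row_mx. Qed.

Lemma dot_quarterC u v : dot u (quarter v) = - dot v (quarter u).
Proof.
have E (x y : 'rV[R]_(n + n)) : dot x (quarter y) = dot (lsubmx x) (rsubmx y)
    - dot (rsubmx x) (lsubmx y).
  by rewrite -[in LHS](hsubmxK x) /quarter dot_row_mx dotNr.
by rewrite !E opprB (dotC (rsubmx u)) (dotC (lsubmx u)).
Qed.

Lemma dot_quarter u : dot u (quarter u) = 0.
Proof. have := dot_quarterC u u; lra. Qed.

Lemma dot_quarter2 u v : dot (quarter u) (quarter v) = dot u v.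
Proof.
rewrite /quarter dot_row_mx !dotE opprK addrC -dot_row_mx.
by rewrite !hsubmxK.
Qed.

(** Bessel's inequality for the orthogonal vectors [v] and [quarter v]. *)
Lemma bessel_quarter u v :
  dot u v ^+ 2 + dot u (quarter v) ^+ 2 <= dot u u * dot v v.
Proof.
have [->|v0] := eqVneq v 0.
  have q0 : quarter (0 : 'rV[R]_(n + n)) = 0.
    by rewrite /quarter !linear0 ?oppr0 row_mx0.
  by rewrite q0 -(scale0r (0 : 'rV[R]_(n + n))) !dotE !mul0r expr0n/= mulr0 addr0.
have B0 : 0 < dot v v.
  rewrite lt_neqAle dot_ge0 andbT eq_sym; apply: contra_neq v0; exact: dot_eq0.
have := dot_ge0 (dot v v *: u - dot u v *: v - dot u (quarter v) *: quarter v).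
rewrite !dotE dot_quarter2 (dotC v u) (dotC (quarter v) v) (dotC (quarter v) u).
rewrite dot_quarter.
rewrite [X in 0 <= X -> _](_ : _ = dot v v *
  (dot u u * dot v v - (dot u v ^+ 2 + dot u (quarter v) ^+ 2))); last by ring.
by rewrite pmulr_rge0// subr_ge0.
Qed.

End Symplectic.

(** * The Koranyi metric in horizontal and vertical coordinates *)

Section HeisGeometry.
Context {R : realType} {n : nat}.
Local Notation H := (heis R n).
Implicit Types q : H.

Definition hpi q : 'rV[R]_(n + n) := row_mx (hx q) (hy q).

(** The vertical component of [q^-1 * q'], which vanishes exactly when [q'] is
    the right translation of [q] by a horizontal vector. *)
Definition vert q q' : R :=
  hz q' - hz q + 2 * dot (hpi q) (quarter (hpi q')).

Lemma mdist_pow4 q q' : mdist q q' ^+ 4 =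
  dot (hpi q' - hpi q) (hpi q' - hpi q) ^+ 2 + vert q q' ^+ 2.
Proof.
have root4 (a : R) : 0 <= a -> (a `^ 4^-1) ^+ 4 = a.
  by move=> a0; rewrite -powR_mulrn ?powR_ge0// -powRrM mulVf ?powRr1.
rewrite heis_mdistE root4 ?addr_ge0 ?sqr_ge0//.
congr (_ ^+ 2 + _ ^+ 2).
  rewrite /hpi opp_row_mx add_row_mx dot_row_mx /dot -big_split/=.
  by apply: eq_bigr => i _; rewrite !mxE; ring.
rewrite /vert /quarter /hpi row_mxKl row_mxKr dot_row_mx /dot -big_split/=.
congr (_ + 2 * _); first by rewrite addrC.
by apply: eq_bigr => i _; rewrite !mxE; ring.
Qed.

Lemma vert_cocycle q1 q2 q3 : vert q1 q3 = vert q1 q2 + vert q2 q3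
  - 2 * dot (hpi q2 - hpi q1) (quarter (hpi q3 - hpi q2)).
Proof.
rewrite /vert quarterD quarterN !dotE dot_quarter; ring.
Qed.

Lemma enorm_hpi_le q q' : enorm (hpi q' - hpi q) <= mdist q q'.
Proof.
rewrite -(@ler_pXn2r _ 4)// ?nnegrE ?enorm_ge0 ?mdist_ge0//.
by rewrite mdist_pow4 (exprM _ 2 2) enorm_sq lerDl sqr_ge0.
Qed.

Section Translation.
Variables (a b : 'rV[R]_n) (q : H).
Local Notation qU := (heis_mul q (horizontal a b)).

Lemma hpi_right_translation : hpi qU = hpi q + row_mx a b.
Proof. by rewrite /hpi add_row_mx. Qed.

Lemma vert_right_translation : vert q qU = 0.
Proof.
rewrite /vert hpi_right_translation quarterD dotDr dot_quarter add0r.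
rewrite /quarter /hpi row_mxKl row_mxKr dot_row_mx /= /dot -big_split/=.
rewrite addr0 [hz q + _]addrC addrK -mulrDr -big_split/= big1 ?mulr0// => i _.
by rewrite !mxE; ring.
Qed.

Lemma mdist_right_translation : mdist q qU = enorm (row_mx a b).
Proof.
apply/eqP; rewrite -(@eqrXn2 _ 4) ?mdist_ge0 ?enorm_ge0//.
rewrite mdist_pow4 vert_right_translation hpi_right_translation.
by rewrite (addrC (hpi q)) addrK expr0n addr0 (exprM _ 2 2) enorm_sq.
Qed.

End Translation.

(** The quantitative form of the strict convexity of the Koranyi norm: the
    excess in the triangle inequality controls the angle between consecutive
    horizontal displacements and their vertical parts. With [al = (A, z1)],
    [be = (B, z2)] and [om = (S, w)] as plane vectors of norms [x ^ 2], [y ^ 2]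
    and at most [x * y], expanding [(x + y) ^ 4 - r ^ 4] gives a sum of four
    nonnegative Cauchy-Schwarz deficits; two of them already bound [x y - S],
    because [om / (x y)] is close to [al / x ^ 2], which is close to [(1, 0)]
    since [x ^ 2 y ^ 2] is almost reached by [A B]. *)
Lemma triangle_excess_scalar (x y r A B S w z1 z2 : R) :
  0 <= x -> 0 <= y -> 0 <= r -> r <= x + y -> 0 <= A -> 0 <= B ->
  x ^+ 4 = A ^+ 2 + z1 ^+ 2 -> y ^+ 4 = B ^+ 2 + z2 ^+ 2 ->
  S ^+ 2 + w ^+ 2 <= A * B ->
  r ^+ 4 = (A + B + 2 * S) ^+ 2 + (z1 + z2 + 2 * w) ^+ 2 ->
  x * y * (x * y - S) <= 5 * (x + y) ^+ 3 * (x + y - r).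
Proof.
(* The pair of [al] and [om] serves when [y <= x], that of [be] and [om]
   otherwise. *)
wlog yx : x y A B z1 z2 / y <= x.
  move=> hw x0 y0 r0 rxy A0 B0 xE yE Sw rE.
  have [yx|/ltW yx] := leP y x; first exact: (hw x y A B z1 z2).
  rewrite (mulrC x) (addrC x); apply: (hw y x B A z2 z1) => //.
  - by rewrite addrC.
  - by rewrite mulrC.
  - by rewrite rE (addrC A) (addrC z1).
move=> x0 y0 r0 rxy A0 B0 xE yE Sw rE.
have s0 : 0 <= (x + y) ^+ 3 by rewrite exprn_ge0 ?addr_ge0.
have E0 : 0 <= (x + y) ^+ 3 * (x + y - r) by rewrite mulr_ge0 ?subr_ge0.
have [x00|xN0] := eqVneq x 0.
  by rewrite {1}x00 !mul0r -mulrA mulr_ge0.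
have [y00|yN0] := eqVneq y 0.
  by rewrite {1}y00 mulr0 mul0r -mulrA mulr_ge0.
have xp : 0 < x by rewrite lt_neqAle eq_sym xN0.
have yp : 0 < y by rewrite lt_neqAle eq_sym yN0.
have Ax : A <= x ^+ 2.
  by rewrite -(@ler_pXn2r _ 2)// ?nnegrE ?sqr_ge0// -exprM xE lerDl sqr_ge0.
have By : B <= y ^+ 2.
  by rewrite -(@ler_pXn2r _ 2)// ?nnegrE ?sqr_ge0// -exprM yE lerDl sqr_ge0.
have dot2 (u1 u2 v1 v2 k l : R) : 0 <= k -> 0 <= l ->
    u1 ^+ 2 + u2 ^+ 2 <= k ^+ 2 -> v1 ^+ 2 + v2 ^+ 2 <= l ^+ 2 ->
    u1 * v1 + u2 * v2 <= k * l.
  move=> k0 l0 hu hv; apply: le_trans (ler_norm _) _.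
  rewrite -(@ler_pXn2r _ 2)// ?nnegrE ?mulr_ge0// real_normK ?num_real//.
  rewrite exprMn; apply: le_trans (ler_pM _ _ hu hv); rewrite ?addr_ge0 ?sqr_ge0//.
  rewrite -subr_ge0 (_ : _ - _ = (u1 * v2 - u2 * v1) ^+ 2) ?sqr_ge0//.
  by ring.
have ABxy : A * B <= (x * y) ^+ 2 by rewrite exprMn ler_pM.
have Swxy : S ^+ 2 + w ^+ 2 <= (x * y) ^+ 2 by exact: le_trans ABxy.
pose D := (x + y) ^+ 4 - r ^+ 4.
have DE : D = 4 * ((x * y) ^+ 2 - (S ^+ 2 + w ^+ 2))
    + 2 * (x ^+ 2 * y ^+ 2 - (A * B + z1 * z2))
    + 4 * (x ^+ 2 * (x * y) - (A * S + z1 * w))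
    + 4 * (y ^+ 2 * (x * y) - (B * S + z2 * w)).
  rewrite /D rE (_ : (x + y) ^+ 4 = x ^+ 4 + y ^+ 4 + 4 * (x * y) ^+ 2
    + 2 * (x ^+ 2 * y ^+ 2) + 4 * (x ^+ 2 * (x * y)) + 4 * (y ^+ 2 * (x * y)));
    last by ring.
  by rewrite xE yE; ring.
have ab : A * B + z1 * z2 <= x ^+ 2 * y ^+ 2.
  by apply: dot2; rewrite ?sqr_ge0// -exprM ?xE ?yE.
have ac : A * S + z1 * w <= x ^+ 2 * (x * y).
  by apply: dot2; rewrite ?sqr_ge0 ?mulr_ge0// -exprM ?xE.
have bc : B * S + z2 * w <= y ^+ 2 * (x * y).
  by apply: dot2; rewrite ?sqr_ge0 ?mulr_ge0// -exprM ?yE.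
have D1 : (x * y) ^+ 2 - (S ^+ 2 + w ^+ 2) <= D / 4 by rewrite DE; lra.
have D2 : x ^+ 2 * (x * y) - (A * S + z1 * w) <= D / 4 by rewrite DE; lra.
(* The first coordinates of [al / x ^ 2] and of [om / (x y)]. *)
pose a := A / x ^+ 2; pose c := S / (x * y).
have xy0 : 0 < x * y by rewrite mulr_gt0.
have x20 : 0 < x ^+ 2 by rewrite exprn_gt0.
have y20 : 0 < y ^+ 2 by rewrite exprn_gt0.
have key : 2 * (1 - c) <= 4 * (1 - (A * S + z1 * w) / (x ^+ 2 * (x * y)))
    + 4 * (1 - a) + (1 - (S ^+ 2 + w ^+ 2) / (x * y) ^+ 2).
  pose z := z1 / x ^+ 2; pose v := w / (x * y).
  have a2z2 : a ^+ 2 + z ^+ 2 = 1.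
    by rewrite !expr_div_n -mulrDl -xE -exprM divff// expf_neq0.
  have c2v2 : c ^+ 2 + v ^+ 2 = (S ^+ 2 + w ^+ 2) / (x * y) ^+ 2.
    by rewrite !expr_div_n -mulrDl.
  have acv : a * c + z * v = (A * S + z1 * w) / (x ^+ 2 * (x * y)).
    by rewrite /a /c /z /v; field; rewrite xN0 yN0.
  have c2v21 : c ^+ 2 + v ^+ 2 <= 1.
    by rewrite c2v2 ler_pdivrMr ?exprn_gt0// mul1r.
  rewrite -acv -c2v2.
  have : 0 <= (c - a - (a - 1)) ^+ 2 by exact: sqr_ge0.
  have : 0 <= (v - z - z) ^+ 2 by exact: sqr_ge0.
  nra.
have k1 : (x * y) ^+ 2 * (1 - (A * S + z1 * w) / (x ^+ 2 * (x * y))) <= D / 4.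
  rewrite (_ : _ * _ = (y / x) * (x ^+ 2 * (x * y) - (A * S + z1 * w))); last first.
    by field; rewrite xN0 yN0.
  apply: le_trans D2; rewrite ler_piMl ?subr_ge0//.
  by rewrite ler_pdivrMr// mul1r.
have k2 : (x * y) ^+ 2 * (1 - a) <= D / 4.
  rewrite (_ : _ * _ = (x * y) ^+ 2 - A * y ^+ 2); last by rewrite /a; field.
  have : A * B <= A * y ^+ 2 by rewrite ler_wpM2l.
  lra.
have k3 : (x * y) ^+ 2 * (1 - (S ^+ 2 + w ^+ 2) / (x * y) ^+ 2) <= D / 4.
  rewrite mulrBr mulr1 mulrCA divff ?mulr1// expf_neq0// mulf_neq0//.
have : (x * y) ^+ 2 * (2 * (1 - c)) <= (x * y) ^+ 2 *
   (4 * (1 - (A * S + z1 * w) / (x ^+ 2 * (x * y)))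
    + 4 * (1 - a) + (1 - (S ^+ 2 + w ^+ 2) / (x * y) ^+ 2)).
  by rewrite ler_wpM2l ?sqr_ge0.
have -> : (x * y) ^+ 2 * (2 * (1 - c)) = 2 * (x * y * (x * y - S)).
  by rewrite /c; field; rewrite xN0 yN0.
rewrite !mulrDr => h.
have DD : D <= 4 * ((x + y) ^+ 3 * (x + y - r)).
  rewrite /D; move: (x + y) (addr_ge0 x0 y0) rxy => s s0' rs.
  rewrite -subr_ge0 (_ : _ - _ = (s - r) ^+ 2 * (3 * s ^+ 2 + 2 * s * r + r ^+ 2));
    last by ring.
  by rewrite mulr_ge0 ?sqr_ge0// !addr_ge0 ?sqr_ge0 ?mulr_ge0 ?sqr_ge0.
rewrite -mulrA; lra.
Qed.

(** The scalar inequality applies because the vertical parts of consecutive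
    displacements add up to a multiple of their symplectic product, which
    together with their scalar product obeys Bessel's inequality. *)
Lemma triangle_excess q1 q2 q3 :
  mdist q1 q2 * mdist q2 q3 *
    (mdist q1 q2 * mdist q2 q3 - dot (hpi q2 - hpi q1) (hpi q3 - hpi q2)) <=
  5 * (mdist q1 q2 + mdist q2 q3) ^+ 3 *
    (mdist q1 q2 + mdist q2 q3 - mdist q1 q3).
Proof.
set u := hpi q2 - hpi q1; set v := hpi q3 - hpi q2.
apply: (@triangle_excess_scalar _ _ _ (dot u u) (dot v v) _
  (- dot u (quarter v)) (vert q1 q2) (vert q2 q3));
  rewrite ?mdist_ge0 ?dot_ge0 ?metric_triangle ?mdist_pow4 ?sqrrN ?bessel_quarter//.
have -> : hpi q3 - hpi q1 = u + v by rewrite /u /v [RHS]addrC addrA subrK.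
rewrite (vert_cocycle q1 q2 q3) -/u -/v (dotDl u v) !(dotDr u v) (dotC v u).
by congr (_ ^+ 2 + _ ^+ 2); ring.
Qed.

End HeisGeometry.

(** * Strict convexity of powers *)

Section PowerConvexity.
Context {R : realType}.
Variables (p : R) (p1 : 1 < p).
Implicit Types t c x y r : R.

Let p0 : 0 < p. Proof. exact: lt_trans ltr01 p1. Qed.
Let pN0 : p != 0. Proof. by rewrite gt_eqF. Qed.

Lemma powR_mono x y : 0 <= x -> x <= y -> x `^ p <= y `^ p.
Proof.
by move=> x0 xy; rewrite ge0_ler_powR ?(ltW p0)// nnegrE// (le_trans x0).
Qed.

(** Write [t `^ p] as [t * expR ((p - 1) * ln t)]: the exponential is above its
    tangent, and [ln t > 1 - t^-1]. *)
Lemma bernoulli_gt t : 0 <= t -> t != 1 -> 1 + p * (t - 1) < t `^ p.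
Proof.
have hp := p1.
move=> t0 t1; have [->|tN0] := eqVneq t 0; first by rewrite powR0//; lra.
have tp : 0 < t by rewrite lt_neqAle eq_sym tN0.
have lnt0 : ln t != 0 by rewrite ln_eq0.
have hln : t - 1 < t * ln t.
  have : 1 + (- ln t) < expR (- ln t) by rewrite expR_gt1Dx// oppr_eq0.
  rewrite expRN lnK// => h.
  have : t * (1 - ln t) < t * t^-1 by rewrite ltr_pM2l.
  by rewrite divff//; lra.
rewrite -mulr_powRB1//.
have h2 : 1 + (p - 1) * ln t <= t `^ (p - 1).
  by rewrite /powR (negbTE tN0); exact: expR_ge1Dx.
have : t * (1 + (p - 1) * ln t) <= t * t `^ (p - 1) by rewrite ler_pM2l.
nra.
Qed.

Lemma bernoulli_ge t : 0 <= t -> 1 + p * (t - 1) <= t `^ p.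
Proof.
have hp := p1.
move=> t0; have [->|/bernoulli_gt/ltW] := eqVneq t 1; last exact.
by rewrite subrr mulr0 addr0 powR1.
Qed.

Lemma powR_tangent c t : 0 <= c -> 0 <= t ->
  c `^ p + p * c `^ (p - 1) * (t - c) <= t `^ p.
Proof.
have hp := p1.
move=> c0 t0; have [->|cN0] := eqVneq c 0.
  by rewrite !powR0 ?subr_eq0 ?gt_eqF// mulr0 mul0r addr0 powR_ge0.
have cp : 0 < c by rewrite lt_neqAle eq_sym cN0.
have -> : t = c * (t / c) by rewrite mulrCA divff// mulr1.
rewrite powRM ?divr_ge0// -[in X in X + _](mulr1 (c `^ p)).
rewrite (_ : _ + _ = c `^ p * (1 + p * (t / c - 1))).
  by rewrite ler_wpM2l ?powR_ge0// bernoulli_ge// divr_ge0.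
rewrite -(mulr_powRB1 c0 p0) !mulrDr mulr1; congr (_ + _).
by field.
Qed.

(** By convexity the gap to the tangent line grows away from the contact point,
    so it is at least its value at distance [k]. *)
Lemma bernoulli_gap (k : R) : 0 < k -> exists2 g, 0 < g &
  forall t, 0 <= t -> k <= `|t - 1| -> 1 + p * (t - 1) + g <= t `^ p.
Proof.
have hp := p1.
move=> k0.
pose B t := t `^ p - (1 + p * (t - 1)).
have Bgt t : 0 <= t -> t != 1 -> 0 < B t.
  by move=> t0 t1; rewrite subr_gt0 bernoulli_gt.
have up t : 1 + k <= t -> B (1 + k) <= B t.
  move=> kt.
  have c1 : 1 <= (1 + k) `^ (p - 1).
    by rewrite -[leLHS](powRr0 (1 + k)) ler_powR//; lra.
  have h1 : 0 <= 1 + k by lra.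
  have h2 : 0 <= t by lra.
  have : 0 <= p * (((1 + k) `^ (p - 1) - 1) * (t - (1 + k))).
    by rewrite !mulr_ge0 ?subr_ge0// ltW.
  by have := powR_tangent h1 h2; rewrite /B; lra.
have dn t : 0 <= t -> t <= 1 - k -> B (1 - k) <= B t.
  move=> t0 kt.
  have c1 : (1 - k) `^ (p - 1) <= 1.
    apply: (@le_trans _ _ (1 `^ (p - 1))); last by rewrite powR1.
    by rewrite ge0_ler_powR ?nnegrE//; lra.
  have h1 : 0 <= 1 - k by lra.
  have : 0 <= p * ((1 - (1 - k) `^ (p - 1)) * (1 - k - t)).
    by rewrite !mulr_ge0 ?subr_ge0// ltW.
  by have := powR_tangent h1 t0; rewrite /B; lra.
have B1 : 0 < B (1 + k) by apply: Bgt; [lra|rewrite gt_eqF//; lra].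
have [k1|k1] := leP k 1.
  have B2 : 0 < B (1 - k) by apply: Bgt; [lra|rewrite lt_eqF//; lra].
  exists (Num.min (B (1 + k)) (B (1 - k))).
    by rewrite lt_min B1.
  move=> t t0; rewrite ler_normr => /orP[h|h].
    have /up : 1 + k <= t by lra.
    have : Num.min (B (1 + k)) (B (1 - k)) <= B (1 + k) by rewrite ge_min lexx.
    move: (Num.min _ _) => M; rewrite [B t]/B; lra.
  have /(dn _ t0) : t <= 1 - k by lra.
  have : Num.min (B (1 + k)) (B (1 - k)) <= B (1 - k).
    by rewrite ge_min lexx orbT.
  move: (Num.min _ _) => M; rewrite [B t]/B; lra.
exists (B (1 + k)) => //.
move=> t t0; rewrite ler_normr => /orP[h|h]; last lra.
have /up : 1 + k <= t by lra.
rewrite [B t]/B; lra.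
Qed.

Lemma powR_mean x y : 0 <= x -> 0 <= y ->
  2 * ((x + y) / 2) `^ p <= x `^ p + y `^ p.
Proof.
have hp := p1.
move=> x0 y0; set c := (x + y) / 2.
have c0 : 0 <= c by rewrite divr_ge0// addr_ge0.
have := powR_tangent c0 x0; have := powR_tangent c0 y0.
have -> : y - c = - (x - c) by rewrite /c; field.
lra.
Qed.

Lemma powR_mean_gap (k : R) : 0 < k -> exists2 g, 0 < g &
  forall x y, 0 <= x -> 0 <= y -> k * (x + y) <= `|x - y| ->
  2 * ((x + y) / 2) `^ p + g * ((x + y) / 2) `^ p <= x `^ p + y `^ p.
Proof.
have hp := p1.
move=> /bernoulli_gap[g g0 hg]; exists g => // x y x0 y0.
set c := (x + y) / 2 => hk.
have [c00|cN0] := eqVneq c 0.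
  by rewrite c00 powR0// !mulr0 addr0 addr_ge0 ?powR_ge0.
have c0 : 0 < c by rewrite lt_neqAle eq_sym cN0 divr_ge0// addr_ge0.
pose t := x / c; pose s := y / c.
have t0 : 0 <= t by rewrite divr_ge0// ltW.
have s0 : 0 <= s by rewrite divr_ge0// ltW.
have -> : x = c * t by rewrite /t mulrCA divff// mulr1.
have -> : y = c * s by rewrite /s mulrCA divff// mulr1.
rewrite !(powRM _ (ltW c0))// -mulrDl -mulrDr mulrC ler_wpM2l ?powR_ge0//.
have ts : s - 1 = - (t - 1).
  have : t + s = 2 by rewrite /t /s -mulrDl -/c /c; field; move: cN0; rewrite /c mulf_eq0 negb_or => /andP[].
  lra.
have kt : k <= `|t - 1|.
  rewrite (_ : t - 1 = (x - y) / (x + y)); last first.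
    rewrite /t /c; field; move: cN0; rewrite /c mulf_eq0 negb_or => /andP[-> _].
    done.
  have xy0 : 0 < x + y by move: c0; rewrite /c; lra.
  by rewrite normrM normfV (gtr0_norm xy0) ler_pdivlMr.
have := hg t t0 kt; have := bernoulli_ge s0; rewrite ts; lra.
Qed.

(** The bound [t `^ p <= t] on the unit interval, made homogeneous. *)
Lemma powR_sub_ge x r : 0 <= r -> r <= x ->
  (x - r) / x * x `^ p <= x `^ p - r `^ p.
Proof.
have hp := p1.
move=> r0 rx; have [x00|xN0] := eqVneq x 0.
  have -> : r = 0 by lra.
  by rewrite x00 powR0// mulr0 subrr.
have x0 : 0 < x by rewrite lt_neqAle eq_sym xN0 (le_trans r0).
have [->|rN0] := eqVneq r 0.
  by rewrite powR0// !subr0 divff// mul1r.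
have rp : 0 < r by rewrite lt_neqAle eq_sym rN0.
have : (r / x) `^ p <= r / x.
  apply: ge1r_powR; last exact: ltW.
  by rewrite divr_gt0//= ler_pdivrMr// mul1r.
have -> : r `^ p = x `^ p * (r / x) `^ p.
  by rewrite -powRM ?divr_ge0// ?ltW//; congr powR; field.
have := powR_gt0 p x0.
have -> : (x - r) / x = 1 - r / x by field.
nra.
Qed.

End PowerConvexity.

(** * The defect of a path of three points *)

Section Defect.
Context {R : realType} {n : nat}.
Variables (p : R) (p1 : 1 < p).
Implicit Types q : heis R n.

(** The change of the horizontal displacement, plus the part of the second
    length that its horizontal displacement does not account for: both vanish on
    an evenly parametrised horizontal segment. *)
Definition defect q1 q2 q3 : R :=
  enorm ((hpi q2 - hpi q1) - (hpi q3 - hpi q2)) +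
  (mdist q2 q3 - enorm (hpi q3 - hpi q2)).

Lemma defect_ge0 q1 q2 q3 : 0 <= defect q1 q2 q3.
Proof. by rewrite addr_ge0 ?enorm_ge0// subr_ge0 enorm_hpi_le. Qed.

Lemma defect_le q1 q2 q3 :
  defect q1 q2 q3 <= 2 * (mdist q1 q2 + mdist q2 q3).
Proof.
rewrite /defect; have := enormB (hpi q2 - hpi q1) (hpi q3 - hpi q2).
have := enorm_hpi_le q1 q2; have := enorm_hpi_le q2 q3.
have := enorm_ge0 (hpi q3 - hpi q2).
have := @mdist_ge0 _ _ q1 q2; lra.
Qed.

(** When the two lengths are nearly equal and nearly add up to the total length,
    [triangle_excess] makes the displacements nearly parallel and their scalar
    product nearly the product of the lengths. *)
Lemma defect_small (k : R) q1 q2 q3 : 0 < k -> k <= 2^-1 ->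
  let s := mdist q1 q2 + mdist q2 q3 in
  `|mdist q1 q2 - mdist q2 q3| <= k * s ->
  s - mdist q1 q3 <= k ^+ 2 * s ->
  defect q1 q2 q3 <= 200 * k * s.
Proof.
move=> k0 k1 s; have := triangle_excess q1 q2 q3; rewrite -/s /defect.
have := enorm_hpi_le q1 q2; have := enorm_hpi_le q2 q3.
set u := hpi q2 - hpi q1; set v := hpi q3 - hpi q2.
have := enormB u v; have := dot_le u v; have := enormB_sq u v.
have := enorm_ge0 u; have := enorm_ge0 v; have := enorm_ge0 (u - v).
have : 0 <= mdist q1 q2 by exact: mdist_ge0.
have : 0 <= mdist q2 q3 by exact: mdist_ge0.
rewrite /s; move: (mdist q1 q2) (mdist q2 q3) (mdist q1 q3) => x y r {s}.
move: (enorm u) (enorm v) (enorm (u - v)) (dot u v) => a b e S.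
move=> y0 x0 e0 b0 a0 eE Sab eab yb xa exc xy sr.
set s := x + y; have s0 : 0 <= s by rewrite addr_ge0.
have [s00|sN0] := eqVneq s 0.
  by move: s00; rewrite /s => s00; rewrite s00; lra.
have sp : 0 < s by rewrite lt_neqAle eq_sym sN0.
have [xl yl] : s / 4 <= x /\ s / 4 <= y.
  have ks : k * s <= s / 2 by rewrite mulrC ler_wpM2l.
  by move: xy ks; rewrite ler_norml /s => /andP[]; lra.
have xyS : x * y - S <= 80 * k ^+ 2 * s ^+ 2.
  have xyl : s ^+ 2 / 16 <= x * y by nra.
  have h1 : x * y * (x * y - S) <= 5 * s ^+ 3 * (k ^+ 2 * s).
    apply: le_trans exc _; rewrite ler_wpM2l//.
    by rewrite mulr_ge0// exprn_ge0.
  have xyS0 : 0 <= x * y - S by nra.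
  have h2 : s ^+ 2 / 16 * (x * y - S) <= x * y * (x * y - S) by rewrite ler_wpM2r.
  rewrite -(@ler_pM2l _ (s ^+ 2 / 16)) ?divr_gt0 ?exprn_gt0//.
  apply: le_trans h2 (le_trans h1 _).
  by rewrite le_eqVlt; apply/orP; left; apply/eqP; field.
(* [13 ^ 2] exceeds the coefficient [1 + 2 * 80] that polarisation gives. *)
have he : e <= 13 * k * s.
  have k00 := ltW k0; rewrite -(@ler_pXn2r _ 2)// ?nnegrE ?mulr_ge0//.
  have xy2 : (x - y) ^+ 2 <= (k * s) ^+ 2.
    by rewrite -[X in X <= _]real_normK ?num_real// ler_pXn2r ?nnegrE ?mulr_ge0// ltW.
  rewrite eE; have : a ^+ 2 <= x ^+ 2 by rewrite ler_pXn2r ?nnegrE.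
  have : b ^+ 2 <= y ^+ 2 by rewrite ler_pXn2r ?nnegrE.
  have : 0 <= (k * s) ^+ 2 by exact: sqr_ge0.
  nra.
have hb : y - b <= 160 * k * s.
  have h1 : x * (y - b) <= x * y - S by nra.
  have h2 : s / 4 * (y - b) <= x * (y - b) by rewrite ler_wpM2r ?subr_ge0.
  rewrite -(@ler_pM2l _ (s / 4)) ?divr_gt0//.
  apply: le_trans h2 (le_trans h1 (le_trans xyS _)).
  rewrite [leRHS](_ : _ = 40 * k * s ^+ 2); last by field.
  rewrite ler_wpM2r ?sqr_ge0//.
  nra.
have : 0 <= k * s by rewrite mulr_ge0// ltW.
lra.
Qed.

(** If the two lengths are uneven, or clearly add up to more than the total
    length, then strict convexity makes the last bracket at least a multiple of
    the [p]-th power of the sum of the lengths, which dominates the defect.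
    Otherwise [defect_small] applies, and its bound is absorbed by [eta]. *)
Lemma defect_powR (eta : R) : 0 < eta -> exists2 K, 0 <= K & forall q1 q2 q3,
  defect q1 q2 q3 `^ p <= eta * (mdist q1 q2 `^ p + mdist q2 q3 `^ p) +
    K * (mdist q1 q2 `^ p + mdist q2 q3 `^ p - 2 * (mdist q1 q3 / 2) `^ p).
Proof.
have hp := p1; move=> eta0; have p0 : 0 < p by lra.
have p2 : 0 < 2 `^ p :> R by rewrite powR_gt0.
have p21 : 1 <= 2 `^ p :> R.
  by rewrite -[leLHS](powRr0 2) ler_powR// ?ler1n// ltW.
have p4 : 0 <= 4 `^ p :> R by exact: powR_ge0.
(* With [k := m / (2 * D)], the bound of [defect_small] is [m] times the mean of
   the two lengths. *)
have [D [D1 DE]] : exists D : R, 1 <= D /\ 200 = D.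
  by exists 200; rewrite ler1n.
pose m := Num.min 1 (eta / 2 `^ p).
have m0 : 0 < m by rewrite lt_min ltr01 divr_gt0.
have m1 : m <= 1 by rewrite ge_min lexx.
have meta : m * 2 `^ p <= eta by rewrite -ler_pdivlMr// ge_min lexx orbT.
clearbody m.
have D0 : 0 < D := lt_le_trans ltr01 D1.
pose k := m / (2 * D).
have k0 : 0 < k by rewrite divr_gt0// mulr_gt0.
have km : D * k = m / 2 by rewrite /k; field; exact: lt0r_neq0.
have k12 : k <= 2^-1.
  have : k <= D * k by rewrite ler_peMl// ltW.
  rewrite km; lra.
clearbody k.
have [g g0 hg] := powR_mean_gap p1 k0.
pose K := 4 `^ p / g + 4 `^ p / (2 * k ^+ 2).
have K1 : 0 <= 4 `^ p / g by apply: divr_ge0 => //; exact: ltW.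
have K2 : 0 <= 4 `^ p / (2 * k ^+ 2) by rewrite divr_ge0// mulr_ge0 ?sqr_ge0.
exists K; first exact: addr_ge0.
move=> q1 q2 q3.
have := @defect_small k q1 q2 q3 k0 k12; rewrite DE km.
have := defect_le q1 q2 q3.
have := defect_ge0 q1 q2 q3; have := @metric_triangle _ _ q1 q2 q3.
have : 0 <= mdist q1 q2 by exact: mdist_ge0.
have : 0 <= mdist q2 q3 by exact: mdist_ge0.
have : 0 <= mdist q1 q3 by exact: mdist_ge0.
move: (mdist q1 q2) (mdist q2 q3) (mdist q1 q3) (defect q1 q2 q3) => x y r h.
move=> r0 y0 x0 rxy h0 hle hsmall.
have mean := powR_mean p1 x0 y0.
have s0 : 0 <= x + y by rewrite addr_ge0.
have c0 : 0 <= (x + y) / 2 by rewrite divr_ge0.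
have rc : (r / 2) `^ p <= ((x + y) / 2) `^ p.
  by apply: powR_mono => //; move: r0 rxy; clear; lra.
set F := x `^ p + y `^ p - 2 * (r / 2) `^ p.
have F0 : 0 <= F by rewrite /F; move: mean rc; clear; lra.
have xy0 : 0 <= x `^ p + y `^ p by rewrite addr_ge0 ?powR_ge0.
have hc : h `^ p <= 4 `^ p * ((x + y) / 2) `^ p.
  rewrite -powRM//; apply: powR_mono => //.
  by move: hle; clear; lra.
have KF : 0 <= K * F by rewrite mulr_ge0// addr_ge0.
have eF : 0 <= eta * (x `^ p + y `^ p) by rewrite mulr_ge0// ltW.
have [uneven|even] := leP (k * (x + y)) `|x - y|.
  have gF : g * ((x + y) / 2) `^ p <= F.
    by have := hg x y x0 y0 uneven; rewrite /F; move: rc; clear; lra.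
  have : 4 `^ p * ((x + y) / 2) `^ p <= 4 `^ p / g * F.
    rewrite -mulrA ler_wpM2l ?powR_ge0//.
    by rewrite ler_pdivlMl.
  have : 0 <= 4 `^ p / (2 * k ^+ 2) * F by rewrite mulr_ge0.
  rewrite /K [(_ + _) * F]mulrDl; move: hc eF; clear; lra.
have [long|short] := leP (k ^+ 2 * (x + y)) (x + y - r).
  have gF : 2 * k ^+ 2 * ((x + y) / 2) `^ p <= F.
    have [s00|sN0] := eqVneq (x + y) 0.
      by rewrite s00 mul0r powR0 ?gt_eqF// mulr0.
    have sp : 0 < x + y by rewrite lt_neqAle eq_sym sN0.
    have r2 : 0 <= r / 2 by rewrite divr_ge0.
    have rs2 : r / 2 <= (x + y) / 2 by move: rxy; clear; lra.
    have := powR_sub_ge p1 r2 rs2.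
    have : k ^+ 2 <= ((x + y) / 2 - r / 2) / ((x + y) / 2).
      rewrite ler_pdivlMr ?divr_gt0//; move: long; clear; lra.
    have := powR_ge0 ((x + y) / 2) p.
    rewrite /F; move: mean; clear; nra.
  have h1 : 4 `^ p * ((x + y) / 2) `^ p <= 4 `^ p / (2 * k ^+ 2) * F.
    rewrite -mulrA ler_wpM2l ?powR_ge0//.
    by rewrite ler_pdivlMl ?mulr_gt0// exprn_gt0.
  apply: (le_trans hc); apply: (le_trans h1).
  by rewrite /K [(_ + _) * F]mulrDl addrA lerDr addr_ge0// mulr_ge0.
have hk : h <= m * ((x + y) / 2).
  by have := hsmall (ltW even) (ltW short); rewrite mulrAC mulrA.
have hkp : h `^ p <= m * ((x + y) / 2) `^ p.
  apply: (@le_trans _ _ ((m * ((x + y) / 2)) `^ p)).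
    exact: powR_mono.
  rewrite (powRM _ (ltW m0) c0) ler_wpM2r ?powR_ge0//.
  by apply: ge1r_powR; [rewrite m0 m1|exact: ltW].
have : m * ((x + y) / 2) `^ p <= eta * ((x + y) / 2) `^ p.
  rewrite ler_wpM2r ?powR_ge0//; apply: le_trans meta.
  by rewrite ler_peMr// ltW.
have : eta * ((x + y) / 2) `^ p <= eta * (x `^ p + y `^ p).
  rewrite ler_wpM2l ?(ltW eta0)//; have := powR_ge0 ((x + y) / 2) p; lra.
lra.
Qed.

End Defect.

(** * Norms of order p on a probability space *)

Section Norms.
Context {R : realType}.
Variables (p : R) (p1 : 1 < p).
Context d (T : measurableType d) (mu : probability T R).
Implicit Types f g : T -> R.
Local Open Scope ereal_scope.

Let p0 : (0 < p)%R. Proof. exact: lt_trans ltr01 p1. Qed.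

Definition lpnorm f : \bar R := 'N[mu]_p%:E[EFin \o f].

Lemma lpnorm_pow f : (forall x, 0 <= f x)%R ->
  lpnorm f `^ p = \int[mu]_x (f x `^ p)%:E.
Proof.
move=> f0; rewrite /lpnorm (@poweR_Lnorm _ _ _ _ _ _ (lt0r_neq0 p0)).
by apply: eq_integral => x _ /=; rewrite ger0_norm.
Qed.

Lemma poweR_mono (x y : \bar R) : 0 <= x -> 0 <= y ->
  (x `^ p <= y `^ p) = (x <= y).
Proof.
move=> x0 y0; apply/idP/idP => h; last first.
  by apply: gt0_ler_poweR; rewrite ?in_itv/= ?x0 ?y0 ?leey ?(ltW p0).
have pK (z : \bar R) : 0 <= z -> (z `^ p) `^ p^-1 = z.
  by move=> z0; rewrite -poweRrM divff ?gt_eqF// poweRe1.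
rewrite -(pK x)// -(pK y)//.
by apply: gt0_ler_poweR; rewrite ?in_itv/= ?poweR_ge0 ?leey ?invr_ge0 ?(ltW p0).
Qed.

Lemma lpnorm_ge0 f : 0 <= lpnorm f. Proof. exact: Lnorm_ge0. Qed.

Lemma lpnorm_le f c : (forall x, 0 <= f x)%R -> (0 <= c)%R ->
  (lpnorm f <= c%:E) = (\int[mu]_x (f x `^ p)%:E <= (c `^ p)%:E).
Proof. by move=> f0 c0; rewrite -lpnorm_pow// -poweR_EFin poweR_mono// lpnorm_ge0. Qed.

Lemma lpnorm_ge f c : (forall x, 0 <= f x)%R -> (0 <= c)%R ->
  (c%:E <= lpnorm f) = ((c `^ p)%:E <= \int[mu]_x (f x `^ p)%:E).
Proof. by move=> f0 c0; rewrite -lpnorm_pow// -poweR_EFin poweR_mono// lpnorm_ge0. Qed.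

Lemma measurable_fun_powR f : measurable_fun [set: T] f ->
  measurable_fun [set: T] (fun x => f x `^ p)%R.
Proof. exact: (@measurableT_comp _ _ _ _ _ _ (@powR R ^~ p)). Qed.

Lemma measurable_powR_EFin f : measurable_fun [set: T] f ->
  measurable_fun [set: T] (fun x => (f x `^ p)%:E).
Proof. by move=> mf; apply/measurable_EFinP; exact: measurable_fun_powR. Qed.

Lemma lpnorm_mono f g : measurable_fun [set: T] f -> measurable_fun [set: T] g ->
  (forall x, 0 <= f x <= g x)%R -> lpnorm f <= lpnorm g.
Proof.
move=> mf mg fg; have f0 x : (0 <= f x)%R by case/andP: (fg x).
have g0 x : (0 <= g x)%R by case/andP: (fg x) => ? ?; exact: le_trans (f0 x) _.
rewrite -poweR_mono ?lpnorm_ge0// !lpnorm_pow//.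
apply: ge0_le_integral => //; try exact: measurable_powR_EFin.
- by move=> x _; rewrite lee_fin powR_ge0.
- by move=> x _; rewrite lee_fin; apply: powR_mono => //; case/andP: (fg x).
Qed.

Lemma lpnormD f g a b : measurable_fun [set: T] f -> measurable_fun [set: T] g ->
  lpnorm f <= a%:E -> lpnorm g <= b%:E ->
  lpnorm (fun x => f x + g x)%R <= (a + b)%:E.
Proof.
move=> mf mg fa gb; rewrite EFinD.
apply: le_trans (leeD fa gb); apply: minkowski_EFin => //; exact: ltW.
Qed.

Lemma integral_cst_probability c : \int[mu]_x c%:E = c%:E.
Proof.
by rewrite integral_cst// -[RHS]mule1; congr (_ * _); exact: probability_setT.
Qed.

Lemma lpnorm_cst c : (0 <= c)%R -> lpnorm (fun=> c) = c%:E.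
Proof.
move=> c0; apply/eqP; rewrite eq_le lpnorm_le// lpnorm_ge//.
by rewrite integral_cst_probability lexx.
Qed.

(** Integrate the tangent line of the power at [c]. *)
Lemma integral_le_lpnorm f c : measurable_fun [set: T] f ->
  (forall x, 0 <= f x)%R -> (0 < c)%R -> lpnorm f <= c%:E ->
  \int[mu]_x (f x)%:E <= c%:E.
Proof.
move=> mf f0 c0; rewrite lpnorm_le ?(ltW c0)// => fc.
pose k := (p * c `^ (p - 1))%R.
have k0 : (0 < k)%R by rewrite mulr_gt0// powR_gt0.
have hp := p1.
have h x : (k * f x <= f x `^ p + (p - 1) * c `^ p)%R.
  have := powR_tangent p1 (ltW c0) (f0 x).
  have := mulr_powRB1 (ltW c0) p0; rewrite /k => <-; lra.
have : \int[mu]_x (k * f x)%:E <= \int[mu]_x (f x `^ p + (p - 1) * c `^ p)%:E.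
  apply: ge0_le_integral => //.
  - by move=> x _; rewrite lee_fin mulr_ge0// ltW.
  - by apply/measurable_EFinP; exact: measurable_funM.
  - apply/measurable_EFinP; apply: measurable_funD => //.
    exact: measurable_fun_powR.
  - by move=> x _; rewrite lee_fin.
have q0 : (0 <= (p - 1) * c `^ p)%R by rewrite mulr_ge0 ?powR_ge0 ?subr_ge0 ?ltW.
have -> : \int[mu]_x (f x `^ p + (p - 1) * c `^ p)%:E =
    \int[mu]_x (f x `^ p)%:E + ((p - 1) * c `^ p)%:E.
  under eq_integral do rewrite EFinD.
  rewrite ge0_integralD ?integral_cst_probability//.
  - by move=> x _; rewrite lee_fin powR_ge0.
  - exact: measurable_powR_EFin.
have -> : \int[mu]_x (k * f x)%:E = k%:E * \int[mu]_x (f x)%:E.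
  under eq_integral do rewrite EFinM.
  rewrite ge0_integralZl_EFin//.
  - by move=> x _; rewrite lee_fin.
  - exact/measurable_EFinP.
  - exact: ltW.
move=> h1.
have h2 : k%:E * \int[mu]_x (f x)%:E <= k%:E * c%:E.
  apply: le_trans h1 _; apply: le_trans (leeD2r _ fc) _.
  rewrite -EFinD -EFinM lee_fin /k.
  by rewrite -(mulr_powRB1 (ltW c0) p0) -mulrA (mulrC _ c); lra.
by rewrite lee_pmul2l in h2.
Qed.

End Norms.

(** * Measurability *)

Section Measurability.
Context {R : realType} {n : nat}.
Local Notation H := (heis R n).
Local Notation bH := (borel H).

Lemma continuous_borel_measurable (f : H -> R) :
  continuous f -> measurable_fun [set: bH] (f : bH -> R).
Proof.
move=> cf; apply: (measurability _ (RGenOInfty.measurableE R)) => //.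
move=> _ [_ [a ->] <-]; rewrite setTI; apply: sub_sigma_algebra.
move: cf => /continuousP; apply; exact: interval_open.
Qed.

Lemma mdist_continuous_at (f : H -> R) q :
  (forall e, 0 < e -> exists2 d, 0 < d &
    forall q', mdist q q' < d -> `|f q - f q'| < e) -> {for q, continuous f}.
Proof.
move=> h B /nbhs_ballP[e /= e0 eB]; have [d d0 hd] := h e e0.
apply/nbhs_ballP; exists d => //= q'; rewrite ballEmdist/= => /hd qq'.
exact: eB.
Qed.

Lemma continuous_hpi i : continuous (fun q : H => hpi q 0 i).
Proof.
move=> q; apply: mdist_continuous_at => e e0; exists e => // q' qq'.
apply: le_lt_trans qq'; apply: le_trans (enorm_hpi_le q q').
rewrite -(@ler_pXn2r _ 2)// ?nnegrE ?enorm_ge0// enorm_sq real_normK ?num_real//.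
rewrite /dot (bigD1 i)//= -sqrrN opprB !mxE -expr2 lerDl.
by apply: sumr_ge0 => j _; rewrite -expr2 sqr_ge0.
Qed.

Lemma vert_le (q q' : H) : `|vert q q'| <= mdist q q' ^+ 2.
Proof.
rewrite -(@ler_pXn2r _ 2)// ?nnegrE ?sqr_ge0// real_normK ?num_real//.
by rewrite -exprM mdist_pow4 lerDr sqr_ge0.
Qed.

Lemma enorm_quarter (v : 'rV[R]_(n + n)) : enorm (quarter v) = enorm v.
Proof. by rewrite /enorm dot_quarter2. Qed.

Lemma continuous_hz : continuous (fun q : H => hz q).
Proof.
move=> q; apply: mdist_continuous_at => e e0.
have a0 : 0 <= enorm (hpi q) by exact: enorm_ge0.
pose d := Num.min 1 (e / (2 + 2 * enorm (hpi q))).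
have d0 : 0 < d by rewrite lt_min ltr01 divr_gt0//; lra.
have d1 : d <= 1 by rewrite ge_min lexx.
have de : d * (2 + 2 * enorm (hpi q)) <= e.
  by rewrite -ler_pdivlMr ?ge_min ?lexx ?orbT//; lra.
exists d => // q' qq'.
have -> : hz q - hz q' = 2 * dot (hpi q) (quarter (hpi q' - hpi q)) - vert q q'.
  by rewrite quarterD quarterN dotDr dotNr dot_quarter /vert; ring.
have D0 := @mdist_ge0 _ _ q q'.
apply: le_lt_trans (ler_normB _ _) _; rewrite normrM (ger0_norm (ler0n _ 2)).
have := vert_le q q'; have := dot_normr_le (hpi q) (quarter (hpi q' - hpi q)).
rewrite enorm_quarter; have := enorm_hpi_le q q'.
have : mdist q q' ^+ 2 <= mdist q q' * d by rewrite expr2 ler_wpM2l// ltW.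
have : enorm (hpi q) * mdist q q' <= enorm (hpi q) * d by rewrite ler_wpM2l// ltW.
move: (enorm (hpi q' - hpi q)) (`|dot _ _|) => u w h1 h2 h3 h4 h5.
have : enorm (hpi q) * u <= enorm (hpi q) * mdist q q' by rewrite ler_wpM2l.
have : mdist q q' * d <= mdist q q' by rewrite ler_piMr.
lra.
Qed.

Context d (T : measurableType d).
Implicit Types X Y Z : T -> bH.

Lemma measurable_hpi X i : measurable_fun [set: T] X ->
  measurable_fun [set: T] (fun w => hpi (X w) 0 i).
Proof.
move=> mX.
exact: (measurableT_comp (continuous_borel_measurable (@continuous_hpi i)) mX).
Qed.

Lemma measurable_hz X : measurable_fun [set: T] X ->
  measurable_fun [set: T] (fun w => hz (X w)).
Proof.
move=> mX.
exact: (measurableT_comp (continuous_borel_measurable continuous_hz) mX).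
Qed.

Lemma measurable_dot m (U V : T -> 'rV[R]_m) :
  (forall i, measurable_fun [set: T] (fun w => U w 0 i)) ->
  (forall i, measurable_fun [set: T] (fun w => V w 0 i)) ->
  measurable_fun [set: T] (fun w => dot (U w) (V w)).
Proof. by move=> mU mV; apply: measurable_sum => i; exact: measurable_funM. Qed.

Lemma measurable_enorm m (U : T -> 'rV[R]_m) :
  (forall i, measurable_fun [set: T] (fun w => U w 0 i)) ->
  measurable_fun [set: T] (fun w => enorm (U w)).
Proof.
move=> mU; rewrite (_ : (fun w => _) = (fun w => dot (U w) (U w) `^ 2^-1)).
  by apply: measurable_fun_powR; exact: measurable_dot.
by apply/funext => w; rewrite powR12_sqrt// dot_ge0.
Qed.

Lemma measurable_hpiB X Y i :
  measurable_fun [set: T] X -> measurable_fun [set: T] Y ->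
  measurable_fun [set: T] (fun w => (hpi (Y w) - hpi (X w)) 0 i).
Proof.
move=> mX mY.
rewrite (_ : (fun w => _) = (fun w => hpi (Y w) 0 i - hpi (X w) 0 i)).
  by apply: measurable_funB; exact: measurable_hpi.
by apply/funext => w; rewrite !mxE.
Qed.

Lemma measurable_quarter (V : T -> 'rV[R]_(n + n)) i :
  (forall j, measurable_fun [set: T] (fun w => V w 0 j)) ->
  measurable_fun [set: T] (fun w => quarter (V w) 0 i).
Proof.
move=> mV; case: (split_ordP i) => j ->.
  rewrite (_ : (fun w => _) = (fun w => V w 0 (rshift n j))) ?mV//.
  by apply/funext => w; rewrite row_mxEl mxE.
rewrite (_ : (fun w => _) = (fun w => - V w 0 (lshift n j))).
  by apply: measurableT_comp => //; exact: measurable_oppr.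
by apply/funext => w; rewrite row_mxEr !mxE.
Qed.

Lemma measurable_mdist X Y :
  measurable_fun [set: T] X -> measurable_fun [set: T] Y ->
  measurable_fun [set: T] (fun w => @mdist R H (X w) (Y w)).
Proof.
move=> mX mY; have mXY i := measurable_hpiB i mX mY.
rewrite (_ : (fun w => _) = (fun w =>
  (dot (hpi (Y w) - hpi (X w)) (hpi (Y w) - hpi (X w)) ^+ 2 +
   vert (X w) (Y w) ^+ 2) `^ 4^-1)).
  apply: measurable_fun_powR; apply: measurable_funD; apply: measurable_funX.
    exact: measurable_dot.
  apply: measurable_funD.
    by apply: measurable_funB; exact: measurable_hz.
  apply: measurable_funM => //; apply: measurable_dot => i.
    exact: measurable_hpi.
  by apply: measurable_quarter => j; exact: measurable_hpi.
apply/funext => w; rewrite -mdist_pow4 -powR_mulrn ?mdist_ge0// -powRrM.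
by rewrite mulfV// powRr1 ?mdist_ge0.
Qed.

Lemma measurable_defect X Y Z : measurable_fun [set: T] X ->
  measurable_fun [set: T] Y -> measurable_fun [set: T] Z ->
  measurable_fun [set: T] (fun w => defect (X w) (Y w) (Z w)).
Proof.
move=> mX mY mZ; have mXY i := measurable_hpiB i mX mY.
have mYZ i := measurable_hpiB i mY mZ.
apply: measurable_funD.
  apply: measurable_enorm => i.
  rewrite (_ : (fun w => _) = (fun w => (hpi (Y w) - hpi (X w)) 0 i -
     (hpi (Z w) - hpi (Y w)) 0 i)); first exact: measurable_funB.
  by apply/funext => w; rewrite !mxE.
by apply: measurable_funB; [exact: measurable_mdist|exact: measurable_enorm].
Qed.

End Measurability.

(** * Laws of random points *)

Definition mfun_of d d' (T : measurableType d)
    (T' : measurableType d') (X : T -> T') (mX : measurable_fun [set: T] X) :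
    {mfun T >-> T'} := HB.pack X (isMeasurableFun.Build _ _ _ _ X mX).

Definition has_law {R : realType} d d' (T : measurableType d)
    (T' : measurableType d') (G : probability T R) (X : T -> T')
    (mu : probability T' R) : Prop :=
  measurable_fun [set: T] X /\ eq_meas (pushforward G X) mu.

Section Transfer.
Context {R : realType} d d' (T : measurableType d) (T' : measurableType d').
Variables (p : R) (G : probability T R).
Implicit Types (X : T -> T') (mu : probability T' R).
Local Open Scope ereal_scope.

Lemma has_law_ge0_integral X mu (f : T' -> \bar R) : has_law G X mu ->
  measurable_fun [set: T'] f -> (forall q, 0 <= f q) ->
  \int[G]_w f (X w) = \int[mu]_q f q.
Proof.
move=> [mX lX] mf f0.
transitivity (\int[distribution G (mfun_of mX)]_q f q).
  by rewrite ge0_integral_distribution.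
by apply: eq_measure_integral => A mA _; exact: lX.
Qed.

Lemma has_law_lpnorm X mu (f : T' -> R) : has_law G X mu ->
  measurable_fun [set: T'] f -> (forall q, 0 <= f q)%R ->
  lpnorm p G (fun w => f (X w)) = lpnorm p mu f.
Proof.
move=> lX mf f0; rewrite /lpnorm unlock; congr (_ `^ _).
apply: (has_law_ge0_integral (f := fun q => `|(f q)%:E| `^ p) lX).
- rewrite (_ : (fun q => _) = (fun q => (f q `^ p)%:E)).
    exact: measurable_powR_EFin.
  by apply/funext => q /=; rewrite ger0_norm.
- by move=> q; exact: poweR_ge0.
Qed.

Lemma has_law_integrable X mu (f : T' -> R) : has_law G X mu ->
  measurable_fun [set: T'] f -> mu.-integrable setT (EFin \o f) ->
  G.-integrable setT (fun w => (f (X w))%:E).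
Proof.
move=> lX mf /integrableP[mEf fy]; apply/integrableP; split.
  by apply/measurable_EFinP; exact: (measurableT_comp mf lX.1).
rewrite (@has_law_ge0_integral _ _ (fun q => `|(f q)%:E|) lX)//.
exact: measurableT_comp.
Qed.

Lemma has_law_Rintegral X mu (f : T' -> R) : has_law G X mu ->
  measurable_fun [set: T'] f -> mu.-integrable setT (EFin \o f) ->
  (\int[G]_w f (X w) = \int[mu]_q f q)%R.
Proof.
move=> lX mf intf; have intfX := has_law_integrable lX mf intf.
rewrite /Rintegral; congr fine.
have mEf : measurable_fun [set: T'] (EFin \o f) by exact/measurable_EFinP.
transitivity (\int[distribution G (mfun_of lX.1)]_q (f q)%:E).
  have := @integral_pushforward _ _ _ _ _ _ lX.1 G setT (EFin \o f) mEf.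
  by rewrite preimage_setT => /(_ intfX measurableT) ->.
by apply: eq_measure_integral => A mA _; exact: lX.2.
Qed.

Lemma has_law_comp d2 (T2 : measurableType d2) X mu (Y : T' -> T2)
    (nu : probability T2 R) :
  has_law G X mu -> has_law mu Y nu -> has_law G (fun w => Y (X w)) nu.
Proof.
move=> [mX lX] [mY lY]; split; first exact: measurableT_comp.
move=> B mB; rewrite -lY// /pushforward -lX//.
by rewrite -[X in measurable X]setTI; exact: mY.
Qed.

End Transfer.

Section Moments.
Context {R : realType} {n : nat}.
Local Notation H := (heis R n).
Local Notation bH := (borel H).
Variables (p : R) (p1 : 1 < p).
Implicit Types (mu : probability bH R).
Local Open Scope ereal_scope.

Let p0 : (0 < p)%R. Proof. exact: lt_trans ltr01 p1. Qed.

Lemma Wp_lpnorm mu (q0 : H) : Wp p mu -> exists2 c, (0 < c)%R &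
  lpnorm p mu (fun q => mdist q q0) <= c%:E.
Proof.
move=> [q1]; set I := \int[mu]_q _ => Iy.
have mid (q2 : H) : measurable_fun [set: bH] (fun q => @mdist R H q q2).
  by apply: measurable_mdist => //; exact: measurable_cst.
have I0 : 0 <= I by apply: integral_ge0 => q _; rewrite lee_fin powR_ge0.
pose r := (fine I `^ p^-1)%R.
have r0 : (0 <= r)%R by exact: powR_ge0.
exists (r + (mdist q1 q0 + 1))%R.
  by rewrite ltr_wpDl// ltr_wpDl// mdist_ge0.
have h1 : lpnorm p mu (fun q => mdist q q1) <= r%:E.
  rewrite (lpnorm_le p1)//; last by move=> q; exact: mdist_ge0.
  rewrite /r -powRrM mulVf ?gt_eqF// powRr1 ?fine_ge0//.
  by rewrite fineK// ge0_fin_numE.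
have h2 : lpnorm p mu (fun=> mdist q1 q0) <= (mdist q1 q0 + 1)%:E.
  by rewrite (lpnorm_cst p1) ?mdist_ge0// lee_fin lerDl.
have mc : measurable_fun [set: bH] (fun=> mdist q1 q0) by exact: measurable_cst.
apply: le_trans (lpnormD p1 (mid q1) mc h1 h2).
apply: (lpnorm_mono p1) => //.
- exact: (measurable_funD (mid q1) mc).
- by move=> q; rewrite mdist_ge0 metric_triangle.
Qed.

End Moments.

(** * Expectations and horizontal means *)

Definition hmean {R : realType} {n : nat}
    (mu : probability (borel (heis R n)) R) : 'rV[R]_(n + n) :=
  \row_i \int[mu]_q hpi q 0 i.

Definition expects {R : realType} d (T : measurableType d)
    (G : probability T R) k (Z : T -> 'rV[R]_k) (m : 'rV[R]_k) : Prop :=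
  forall i, G.-integrable setT (fun w => (Z w 0 i)%:E) /\
    \int[G]_w Z w 0 i = m 0 i.

Section Expectations.
Context {R : realType} {d : measure_display} {T : measurableType d}.
Variable G : probability T R.
Variables (p : R) (p1 : 1 < p).

Lemma expectsB k (Z1 Z2 : T -> 'rV[R]_k) m1 m2 :
  expects G Z1 m1 -> expects G Z2 m2 ->
  expects G (fun w => Z1 w - Z2 w) (m1 - m2).
Proof.
move=> h1 h2 i; have [i1 e1] := h1 i; have [i2 e2] := h2 i.
have E : (fun w => (Z1 w - Z2 w) 0 i) = (fun w => Z1 w 0 i - Z2 w 0 i).
  by apply/funext => w; rewrite !mxE.
rewrite E (_ : (fun w => _) = (fun w => (Z1 w 0 i)%:E - (Z2 w 0 i)%:E)%E); last first.
  by apply/funext => w; rewrite -EFinB !mxE.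
split; first exact: integrableB.
by rewrite RintegralB// e1 e2 !mxE.
Qed.

Lemma expects_cst k (m : 'rV[R]_k) : expects G (fun=> m) m.
Proof.
move=> i; split.
  apply/integrableP; split; first exact: measurable_cst.
  by rewrite integral_cst_probability ltry.
by rewrite /Rintegral integral_cst_probability.
Qed.

Lemma expects_dot k (Z : T -> 'rV[R]_k) m e : expects G Z m ->
  G.-integrable setT (fun w => (dot e (Z w))%:E) /\
  \int[G]_w dot e (Z w) = dot e m.
Proof.
move=> h; rewrite /dot; elim: (index_enum _) => [|i s [IH1 IH2]].
  under eq_fun do rewrite big_nil; under eq_Rintegral do rewrite big_nil.
  rewrite big_nil /Rintegral integral0/=; split => //; exact: integrable0.
under eq_fun do rewrite big_cons; under eq_Rintegral do rewrite big_cons.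
have [i1 e1] := h i.
have i2 : G.-integrable setT (fun w => (e 0 i * Z w 0 i)%:E).
  by under eq_fun do rewrite EFinM; exact: integrableZl.
rewrite big_cons RintegralD// RintegralZl// e1 IH2; split => //.
by under eq_fun do rewrite EFinD; exact: integrableD.
Qed.

(** Test with the expectation itself: its square norm is the integral of its
    scalar products with [Z]. *)
Lemma expects_le k (Z : T -> 'rV[R]_k) m (f : T -> R) c : expects G Z m ->
  measurable_fun [set: T] f -> (forall w, enorm (Z w) <= f w) -> 0 < c ->
  (lpnorm p G f <= c%:E)%E -> enorm m <= c.
Proof.
move=> h mf Zf c0 fc; have [i1 e1] := expects_dot m h.
have [m0|mN0] := eqVneq (enorm m) 0; first by rewrite m0 ltW.
have mp : 0 < enorm m by rewrite lt_neqAle eq_sym mN0 enorm_ge0.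
have f0 w : 0 <= f w by apply: le_trans (Zf w); exact: enorm_ge0.
have fE := integral_le_lpnorm p1 mf f0 c0 fc.
have iF : G.-integrable setT (EFin \o f).
  apply/integrableP; split; first exact/measurable_EFinP.
  under eq_integral do rewrite /= ger0_norm//.
  exact: le_lt_trans fE (ltry _).
have fc' : \int[G]_w f w <= c.
  by rewrite -lee_fin /Rintegral fineK// integrable_fin_num.
rewrite -(ler_pM2l mp) -expr2 enorm_sq -e1.
apply: (@le_trans _ _ (\int[G]_w (enorm m * f w))).
  have iF2 : G.-integrable setT (EFin \o (fun w => enorm m * f w)).
    rewrite (_ : _ \o _ = (fun w => (enorm m)%:E * (f w)%:E)%E)//.
    exact: integrableZl.
  apply: le_Rintegral => //.
  move=> w _; apply: le_trans (dot_le _ _) _.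
  by rewrite ler_wpM2l// ltW.
by rewrite RintegralZl// ler_pM2l.
Qed.

End Expectations.

Section Means.
Context {R : realType} {n : nat}.
Local Notation H := (heis R n).
Local Notation bH := (borel H).
Variables (p : R) (p1 : 1 < p).
Implicit Types (mu nu : probability bH R).

Let p0 : (0 < p)%R. Proof. exact: lt_trans ltr01 p1. Qed.

Lemma hpi0 : hpi (horizontal 0 0 : H) = 0.
Proof. by rewrite /hpi row_mx0. Qed.

Lemma coord_le_enorm k (v : 'rV[R]_k) i : `|v 0 i| <= enorm v.
Proof.
rewrite -(@ler_pXn2r _ 2)// ?nnegrE ?enorm_ge0// enorm_sq real_normK ?num_real//.
rewrite /dot (bigD1 i)//= -expr2 lerDl.
by apply: sumr_ge0 => j _; rewrite -expr2 sqr_ge0.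
Qed.

Lemma integrable_hpi mu i : Wp p mu ->
  mu.-integrable setT (fun q => (hpi (q : H) 0 i)%:E).
Proof.
move=> /(Wp_lpnorm p1 (horizontal 0 0))[c c0 hc].
have mid : measurable_fun [set: bH] (fun q => @mdist R H q (horizontal 0 0)).
  by apply: measurable_mdist => //; exact: measurable_cst.
have d0 (q : bH) : 0 <= @mdist R H q (horizontal 0 0) by exact: mdist_ge0.
have := integral_le_lpnorm p1 mid d0 c0 hc => h.
apply: (@le_integrable _ _ _ mu _ _ _
  (fun q : bH => (@mdist R H q (horizontal 0 0))%:E)) => //.
- by apply/measurable_EFinP; exact: measurable_hpi.
- move=> q _ /=; rewrite lee_fin (ger0_norm (d0 q)) metric_sym.
  apply: le_trans (enorm_hpi_le _ _); rewrite hpi0 subr0.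
  exact: coord_le_enorm.
- apply/integrableP; split; first exact/measurable_EFinP.
  under eq_integral do rewrite /= ger0_norm//.
  exact: le_lt_trans h (ltry _).
Qed.

Context d (T : measurableType d) (G : probability T R).
Implicit Types (X Y : T -> bH).

Lemma has_law_expects X mu : has_law G X mu -> Wp p mu ->
  expects G (fun w => hpi (X w)) (hmean mu).
Proof.
move=> lX Wmu i; have ii := integrable_hpi i Wmu.
have mi : measurable_fun [set: bH] (fun q : bH => hpi q 0 i).
  exact: measurable_hpi.
split; first exact: has_law_integrable lX mi ii.
by rewrite (has_law_Rintegral lX mi ii) mxE.
Qed.

(** The horizontal projection is 1-Lipschitz, and the norm dominates the
    expectation. *)
Lemma hmean_le_lpnorm X Y mu nu c : has_law G X mu -> has_law G Y nu ->
  Wp p mu -> Wp p nu -> 0 < c ->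
  (lpnorm p G (fun w => mdist (X w) (Y w)) <= c%:E)%E ->
  enorm (hmean nu - hmean mu) <= c.
Proof.
move=> lX lY Wmu Wnu c0.
have h := expectsB (has_law_expects lY Wnu) (has_law_expects lX Wmu).
apply: (expects_le p1 h) => //.
- exact: measurable_mdist lX.1 lY.1.
- by move=> w; exact: enorm_hpi_le.
Qed.

End Means.

(** * Optimal costs and horizontal translations *)

Section Couplings.
Context {R : realType} {n : nat}.
Local Notation H := (heis R n).
Local Notation bH := (borel H).
Variables (p : R) (p1 : 1 < p).
Implicit Types (mu nu : probability bH R).
Local Open Scope ereal_scope.

Let p0 : (0 < p)%R. Proof. exact: lt_trans ltr01 p1. Qed.

Let pairdist (w : bH * bH) : R := @mdist R H w.1 w.2.

Let measurable_pairdist : measurable_fun [set: bH * bH] pairdist.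
Proof. by apply: measurable_mdist. Qed.

Let cost_integrand_ge0 (w : bH * bH) : 0 <= (pairdist w `^ p)%:E.
Proof. by rewrite lee_fin powR_ge0. Qed.

Lemma coupling_has_law mu nu (Pi : probability (bH * bH)%type R) :
  coupling mu nu Pi -> has_law Pi fst mu /\ has_law Pi snd nu.
Proof. by move=> [h1 h2]; split; split. Qed.

Lemma cost_lpnorm (Pi : probability (bH * bH)%type R) :
  cost p Pi = lpnorm p Pi pairdist `^ p.
Proof. by rewrite (lpnorm_pow p1)// => w; exact: mdist_ge0. Qed.

Lemma optimal_cost_ge0 mu nu : 0 <= optimal_cost p mu nu.
Proof.
apply: le_ereal_inf_tmp => _ [Pi _ <-].
by apply: integral_ge0 => w _; exact: cost_integrand_ge0.
Qed.

Lemma optimal_cost_le d (T : measurableType d) (G : probability T R)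
    (X Y : T -> bH) mu nu : has_law G X mu -> has_law G Y nu ->
  optimal_cost p mu nu <= \int[G]_w (@mdist R H (X w) (Y w) `^ p)%:E.
Proof.
move=> [mX lX] [mY lY]; pose XY := mfun_of (measurable_fun_pair mX mY).
have mf : measurable_fun [set: bH * bH] (fun w => (pairdist w `^ p)%:E).
  exact: measurable_powR_EFin.
have <- : cost p (distribution G XY) =
    \int[G]_w (@mdist R H (X w) (Y w) `^ p)%:E.
  by rewrite /cost (ge0_integral_distribution XY mf cost_integrand_ge0).
by apply: ereal_inf_lbound; exists (distribution G XY).
Qed.

Lemma optimal_cost_near mu nu c c' : (0 <= c)%R -> (c < c')%R ->
  optimal_cost p mu nu = (c `^ p)%:E ->
  exists2 Pi, coupling mu nu Pi & lpnorm p Pi pairdist <= c'%:E.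
Proof.
move=> c0 cc' oE.
have : optimal_cost p mu nu < (c' `^ p)%:E.
  rewrite oE lte_fin gt0_ltr_powR// ?nnegrE//.
  by rewrite ltW// (le_lt_trans c0).
move=> /ereal_inf_lt[_ [Pi cPi <-]] lt; exists Pi => //.
rewrite (lpnorm_le p1); [exact: ltW|by move=> w; exact: mdist_ge0|].
exact: ltW (le_lt_trans c0 cc').
Qed.

Lemma dWp_eq mu nu c : (0 <= c)%R ->
  (dWp p mu nu = c%:E) <-> (optimal_cost p mu nu = (c `^ p)%:E).
Proof.
move=> c0; rewrite /dWp; split => [h|->].
  rewrite -poweR_EFin -h -poweRrM mulVf ?gt_eqF// poweRe1//.
  exact: optimal_cost_ge0.
by rewrite poweR_EFin -powRrM divff ?gt_eqF// powRr1.
Qed.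

Lemma le_lpnorm d (T : measurableType d) (G : probability T R) (f : T -> R)
    (l : R) :
  (forall c, (0 < c)%R -> lpnorm p G f <= c%:E -> (l <= c)%R) ->
  l%:E <= lpnorm p G f.
Proof.
move=> h; apply/lee_addgt0Pr => e e0.
have := lpnorm_ge0 p G f; case fE : (lpnorm p G f) => [r||]//; last first.
  by move=> _; rewrite addye// leey.
rewrite lee_fin => r0; rewrite -EFinD lee_fin; apply: h.
  by rewrite ltr_wpDl.
by rewrite fE lee_fin lerDl ltW.
Qed.

(** Jensen's inequality for the horizontal projection, which is 1-Lipschitz. *)
Lemma optimal_cost_ge mu nu : Wp p mu -> Wp p nu ->
  (enorm (hmean nu - hmean mu) `^ p)%:E <= optimal_cost p mu nu.
Proof.
move=> Wmu Wnu; apply: le_ereal_inf_tmp => _ [Pi cPi <-].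
have [l1 l2] := coupling_has_law cPi.
rewrite cost_lpnorm -poweR_EFin (poweR_mono p1) ?lpnorm_ge0 ?lee_fin ?enorm_ge0//.
apply: le_lpnorm => c c0 hc.
exact: (hmean_le_lpnorm p1 l1 l2 Wmu Wnu c0 hc).
Qed.

Lemma lpnorm_Wp mu (q0 : H) c : (0 <= c)%R ->
  lpnorm p mu (fun q => mdist q q0) <= c%:E -> Wp p mu.
Proof.
move=> c0; rewrite (lpnorm_le p1)//; last by move=> q; exact: mdist_ge0.
by move=> h; exists q0; exact: le_lt_trans h (ltry _).
Qed.

End Couplings.

Section Translations.
Context {R : realType} {n : nat}.
Local Notation H := (heis R n).
Local Notation bH := (borel H).
Variables (p : R) (p1 : 1 < p).
Implicit Types (mu nu : probability bH R) (a b : 'rV[R]_n).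
Local Open Scope ereal_scope.

Let p0 : (0 < p)%R. Proof. exact: lt_trans ltr01 p1. Qed.

Local Notation translate nu a b :=
  (distribution nu (right_translation (horizontal a b))).

Lemma has_law_id nu : has_law nu id nu.
Proof. by split. Qed.

Lemma has_law_translate nu a b :
  has_law nu (right_translation (horizontal a b)) (translate nu a b).
Proof. by split => //; exact: measurable_right_translation. Qed.

Lemma Wp_translate nu a b : Wp p nu -> Wp p (translate nu a b).
Proof.
move=> /(Wp_lpnorm p1 (horizontal 0 0))[c c0 hc].
have mid : measurable_fun [set: bH] (fun q => @mdist R H q (horizontal 0 0)).
  by apply: measurable_mdist => //; exact: measurable_cst.
have k0 := enorm_ge0 (row_mx a b).
have kc : (0 <= enorm (row_mx a b) + c)%R by apply: addr_ge0 => //; exact: ltW.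
apply: (lpnorm_Wp p1 kc (q0 := horizontal 0 0)).
rewrite -(has_law_lpnorm p (has_law_translate nu a b) mid); last first.
  by move=> q; exact: mdist_ge0.
have hk : lpnorm p nu (fun=> enorm (row_mx a b)) <= (enorm (row_mx a b))%:E.
  by rewrite lpnorm_cst.
have mk : measurable_fun [set: bH] (fun=> enorm (row_mx a b)).
  exact: measurable_cst.
apply: le_trans (lpnormD p1 mk mid hk hc).
apply: (lpnorm_mono p1).
- exact: (measurableT_comp mid (measurable_right_translation _)).
- exact: measurable_funD.
- move=> q; rewrite mdist_ge0/= -(mdist_right_translation a b q).
  by rewrite (metric_sym q (heis_mul _ _)); exact: metric_triangle.
Qed.

Lemma hmean_translate nu a b : Wp p nu ->
  hmean (translate nu a b) = (hmean nu + row_mx a b)%R.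
Proof.
move=> Wnu.
have h1 := has_law_expects p1 (has_law_translate nu a b) (Wp_translate a b Wnu).
have h2 := expectsB (has_law_expects p1 (has_law_id nu) Wnu)
  (expects_cst nu (- row_mx a b)%R).
apply/rowP => i; rewrite -(h1 i).2 -[X in (_ + X)%R]opprK -(h2 i).2.
by congr Rintegral; apply/funext => q; rewrite opprK hpi_right_translation.
Qed.

Lemma translate_cost nu a b :
  \int[nu]_q (@mdist R H q (right_translation (horizontal a b) q) `^ p)%:E =
  (enorm (row_mx a b) `^ p)%:E.
Proof.
rewrite -[RHS](integral_cst_probability nu).
by apply: eq_integral => q _; rewrite mdist_right_translation.
Qed.

(** The translation moves every point by the same distance, which is also the
    displacement of the mean: the lower bound is attained. *)
Lemma optimal_cost_translate nu a b : Wp p nu ->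
  optimal_cost p nu (translate nu a b) = (enorm (row_mx a b) `^ p)%:E.
Proof.
move=> Wnu; apply/eqP; rewrite eq_le; apply/andP; split.
  rewrite -(translate_cost nu).
  exact: optimal_cost_le (has_law_id nu) (has_law_translate nu a b).
have := optimal_cost_ge p1 Wnu (Wp_translate a b Wnu).
by rewrite (hmean_translate a b Wnu) addrAC subrr add0r.
Qed.

Lemma translate_optimal nu a b : Wp p nu ->
  optimal_transport_map p nu (right_translation (horizontal a b)).
Proof.
move=> Wnu; split; first by split.
rewrite (optimal_cost_translate a b Wnu) -(translate_cost nu) /cost.
pose Tr : {mfun bH >-> (bH * bH)%type} :=
  graph_fun (right_translation (horizontal a b)).
rewrite (@ge0_integral_distribution _ _ _ _ _ _ Tr
  (fun w => (@mdist R H w.1 w.2 `^ p)%:E))//.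
  by apply: measurable_powR_EFin; exact: measurable_mdist.
by move=> w; rewrite lee_fin powR_ge0.
Qed.

Lemma optimal_cost_eq mu nu mu' nu' : eq_meas mu mu' -> eq_meas nu nu' ->
  optimal_cost p mu nu = optimal_cost p mu' nu'.
Proof.
move=> h h'; rewrite /optimal_cost; congr (ereal_inf (_ @` _)).
apply/seteqP; split => Pi [h1 h2]; split => A mA.
- by rewrite h1// h.
- by rewrite h2// h'.
- by rewrite h1// h.
- by rewrite h2// h'.
Qed.

End Translations.

(** * Gluing couplings along a partition *)

Section ProbabilityOf.
Context {R : realType} d (T : measurableType d).
Variables (mu : {measure set T -> \bar R}) (mu1 : mu setT = 1%E).

(** The proof argument makes the function a key for the canonical instance. *)
Definition probability_of of mu setT = 1%E : set T -> \bar R := mu.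

HB.instance Definition _ := Measure.copy (probability_of mu1) mu.
HB.instance Definition _ :=
  Measure_isProbability.Build _ _ _ (probability_of mu1) mu1.

End ProbabilityOf.

Section Gluing.
Context {R : realType} d1 d2 d3 (T1 : measurableType d1)
  (T2 : measurableType d2) (T3 : measurableType d3).
Variables (P : probability (T1 * T2)%type R) (Q : probability (T2 * T3)%type R).
Variable A : nat -> set T2.
Hypotheses (mA : forall k, measurable (A k)) (tA : trivIset setT A)
  (cA : \bigcup_k A k = setT).
Hypothesis PQ : eq_meas (pushforward P snd) (pushforward Q fst).
Local Open Scope ereal_scope.

Let mass k : \bar R := P (snd @^-1` A k).

Let mB k : measurable (snd @^-1` A k : set (T1 * T2)).
Proof. by rewrite -[X in measurable X]setTI; exact: measurable_snd. Qed.

Let mC k : measurable (fst @^-1` A k : set (T2 * T3)).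
Proof. by rewrite -[X in measurable X]setTI; exact: measurable_fst. Qed.

Let mass_Q k : Q (fst @^-1` A k) = mass k.
Proof. by rewrite /mass -[RHS]/(pushforward P snd (A k)) PQ. Qed.

Let weight_ge0 k : (0 <= (fine (mass k))^-1)%R.
Proof. by rewrite invr_ge0 fine_ge0// measure_ge0. Qed.

Let mcell k : measurable ((snd @^-1` A k) `*` (fst @^-1` A k)
  : set ((T1 * T2) * (T2 * T3))).
Proof. exact: measurableX. Qed.

Let piece k : {measure set ((T1 * T2) * (T2 * T3)) -> \bar R} :=
  mscale (NngNum (weight_ge0 k)) (mrestr (P \x Q) (mcell k)).

Let glued : {measure set ((T1 * T2) * (T2 * T3)) -> \bar R} := mseries piece 0.

Let gluedE U : glued U = \sum_(k <oo) ((fine (mass k))^-1)%:E *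
  (P \x Q) (U `&` (snd @^-1` A k) `*` (fst @^-1` A k)).
Proof. by []. Qed.

Let mass_weight k (x : \bar R) : 0 <= x <= mass k ->
  ((fine (mass k))^-1)%:E * (x * mass k) = x.
Proof.
move=> /andP[x0 xk].
have mfin : mass k \is a fin_num by rewrite /mass fin_num_measure.
rewrite -(fineK mfin) in xk *; move: (fine (mass k)) xk => m xk.
move: x x0 xk => [x||]//; rewrite !lee_fin => x0 xm.
rewrite -!EFinM; congr (_%:E).
(* On a null cell [x] is zero as well, and the inverse of the mass is [0]. *)
have [m0|m0] := eqVneq m 0%R; last by rewrite mulrCA mulVf// mulr1.
by rewrite m0 invr0 mul0r; apply/eqP; rewrite eq_le x0 -m0.
Qed.

Let preimage_cell_cover d (T : measurableType d) (f : T -> T2) :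
  \bigcup_k (f @^-1` A k) = setT.
Proof. by rewrite -preimage_bigcup cA preimage_setT. Qed.

Let sum_cells d (T : measurableType d) (mu : {measure set T -> \bar R})
    (f : T -> T2) (U : set T) : (forall k, measurable (f @^-1` A k)) ->
  measurable U -> mu U = \sum_(k <oo) mu (U `&` f @^-1` A k).
Proof.
move=> mf mU; rewrite -measure_semi_bigcup.
- by rewrite -setI_bigcupr preimage_cell_cover setIT.
- by move=> k; exact: measurableI.
- apply/trivIsetP => i j _ _ ij; apply/seteqP; split => // w [[_ wi] [_ wj]].
  move/trivIsetP : tA => /(_ i j Logic.I Logic.I ij) AA0.
  by have : (A i `&` A j) (f w) by []; rewrite AA0.
- by rewrite -setI_bigcupr preimage_cell_cover setIT.
Qed.

Let glued_fst U : measurable U -> glued (fst @^-1` U) = P U.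
Proof.
move=> mU; rewrite gluedE (sum_cells _ mB mU); apply: eq_eseriesr => k _.
rewrite (_ : _ `&` _ = (U `&` snd @^-1` A k) `*` (fst @^-1` A k)); last first.
  by apply/seteqP; split => -[x y]/=; tauto.
rewrite product_measure1E//; last exact: measurableI.
rewrite [X in _ * (_ * X)](mass_Q k) mass_weight// measure_ge0/=.
by apply: le_measure; rewrite ?inE//; exact: measurableI.
Qed.

Let glued_snd U : measurable U -> glued (snd @^-1` U) = Q U.
Proof.
move=> mU; rewrite gluedE (sum_cells _ mC mU); apply: eq_eseriesr => k _.
rewrite (_ : _ `&` _ = (snd @^-1` A k) `*` (U `&` fst @^-1` A k)); last first.
  by apply/seteqP; split => -[x y]/=; tauto.
rewrite product_measure1E//; last exact: measurableI.
rewrite [X in _ * X]muleC -/(mass k) mass_weight// measure_ge0/= -mass_Q.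
by apply: le_measure; rewrite ?inE//; exact: measurableI.
Qed.

Let glued_setT : glued setT = 1.
Proof.
by rewrite -[setT](preimage_setT fst) glued_fst//; exact: probability_setT.
Qed.

(** Approximate gluing: conditionally on the cell that contains the common
    point, take the first and the second pair independent. Every set that
    misses the products of cells with themselves is negligible. *)
Lemma partition_gluing : exists G : probability ((T1 * T2) * (T2 * T3))%type R,
  [/\ eq_meas (pushforward G fst) P, eq_meas (pushforward G snd) Q &
   forall N, (forall k w, N w -> A k w.1.2 -> A k w.2.1 -> False) -> G N = 0].
Proof.
exists (probability_of glued_setT); split; [exact: glued_fst|exact: glued_snd|].
move=> N hN; rewrite [LHS]gluedE eseries0// => k _ _.
rewrite (_ : _ `&` _ = set0) ?measure0 ?mule0//.
by apply/seteqP; split => // -[[a b] [c d]] /= [Nw [Ab Ac]]; exact: (hN k _ Nw).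
Qed.

End Gluing.

(** * Small cells in the Heisenberg group *)

Section Cells.
Context {R : realType} {n : nat}.
Local Notation H := (heis R n).
Local Notation bH := (borel H).
Implicit Types q : H.

Lemma rat_approx (x e : R) : 0 < e -> exists r : rat, `|ratr r - x| < e.
Proof.
move=> e0; have [r] := @rat_in_itvoo R (x - e) (x + e) ltac:(lra).
by rewrite in_itv/= => xr; exists r; rewrite ltr_distl.
Qed.

Lemma rat_approx_row k (v : 'rV[R]_k) e : 0 < e ->
  exists r : 'rV[rat]_k, enorm (map_mx ratr r - v) < e.
Proof.
move=> e0; pose s := e / k.+1%:R.
have s0 : 0 < s by rewrite divr_gt0.
pose r i := sval (cid (rat_approx (v 0 i) s0)).
exists (\row_i r i).
rewrite -(@ltr_pXn2r _ 2)// ?nnegrE ?enorm_ge0 ?(ltW e0)// enorm_sq.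
apply: (@le_lt_trans _ _ (\sum_(i < k) s ^+ 2)).
  apply: ler_sum => i _; rewrite -expr2 -real_normK ?num_real// !mxE.
  rewrite ler_pXn2r ?nnegrE ?(ltW s0)// ltW//.
  by rewrite /r; case: cid.
rewrite sumr_const card_ord -mulr_natl /s expr_div_n mulrCA gtr_pMr ?exprn_gt0//.
rewrite ltr_pdivrMr ?exprn_gt0// mul1r -natrX ltr_nat.
by rewrite (leq_trans (ltnSn k))// expnS expn1 leq_pmulr.
Qed.

Definition rational_point (r : 'rV[rat]_(n + n) * rat) : H :=
  let v := map_mx ratr r.1 in Heis (lsubmx v) (rsubmx v) (ratr r.2).

Lemma rational_point_dense q (e : R) : 0 < e ->
  exists r, mdist q (rational_point r) < e.
Proof.
move=> e0; have ee0 : 0 <= e by exact: ltW.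
have c0 := enorm_ge0 (hpi q).
pose K := 2 + 2 * enorm (hpi q).
have K0 : 0 < K by rewrite /K; lra.
pose t := Num.min 1 (e ^+ 2 / (2 * K)).
have t0 : 0 < t by rewrite lt_min ltr01 divr_gt0 ?exprn_gt0 ?mulr_gt0.
have t1 : t <= 1 by rewrite ge_min lexx.
have te : t * (2 * K) <= e ^+ 2.
  by rewrite -ler_pdivlMr ?mulr_gt0// ge_min lexx orbT.
have [v hv] := rat_approx_row (hpi q) t0.
have [z hz'] := rat_approx (hz q) t0.
exists (v, z); set q' := rational_point _.
have piq' : hpi q' = map_mx ratr v by rewrite /hpi hsubmxK.
rewrite -(@ltr_pXn2r _ 4)// ?nnegrE ?mdist_ge0 ?(ltW e0)//.
rewrite mdist_pow4 -enorm_sq piq'.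
have hvert : `|vert q q'| <= t * (1 + 2 * enorm (hpi q)).
  rewrite (_ : vert q q' = (ratr z - hz q) +
    2 * dot (hpi q) (quarter (map_mx ratr v - hpi q))); last first.
    by rewrite /vert piq' quarterD quarterN dotDr dotNr dot_quarter subr0.
  apply: le_trans (ler_normD _ _) _; rewrite normrM (ger0_norm (ler0n _ 2)).
  have := dot_normr_le (hpi q) (quarter (map_mx ratr v - hpi q)).
  rewrite enorm_quarter => h1.
  have : enorm (hpi q) * enorm (map_mx ratr v - hpi q) <= enorm (hpi q) * t.
    by rewrite ler_wpM2l// ltW.
  lra.
have hvert2 : vert q q' ^+ 2 <= (t * (1 + 2 * enorm (hpi q))) ^+ 2.
  by rewrite -real_normK ?num_real// ler_pXn2r ?nnegrE ?mulr_ge0 ?(ltW t0)//; lra.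
have hpi2 : (enorm (map_mx ratr v - hpi q) ^+ 2) ^+ 2 <= t ^+ 2.
  rewrite ler_pXn2r ?nnegrE ?sqr_ge0 ?(ltW t0)//.
  apply: (@le_trans _ _ (t ^+ 2)).
    by rewrite ler_pXn2r ?nnegrE ?enorm_ge0 ?(ltW t0)// ltW.
  by rewrite expr2 ler_piMr// ltW.
apply: (@le_lt_trans _ _ ((t * K) ^+ 2)).
  have : 0 <= t ^+ 2 * enorm (hpi q) by rewrite mulr_ge0 ?sqr_ge0.
  have : 0 <= t ^+ 2 by exact: sqr_ge0.
  by rewrite /K; nra.
rewrite (exprM e 2 2) ltr_pXn2r ?nnegrE ?mulr_ge0 ?sqr_ge0 ?(ltW t0) ?(ltW K0)//.
by apply: lt_le_trans te; rewrite mulrCA ltr_pMl ?mulr_gt0// ltr1n.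
Qed.

Lemma open_mdist_ball q (e : R) : open [set q' : H | mdist q q' < e].
Proof.
rewrite openE => y /= qy; rewrite /interior; apply/nbhs_ballP.
exists (e - mdist q y) => /=; first by rewrite subr_gt0.
move=> z; rewrite ballEmdist/= => yz.
by apply: le_lt_trans (metric_triangle _ y _) _; lra.
Qed.

(** The balls of radius [e / 2] around the rational points cover; make them
    disjoint. *)
Lemma small_cells (e : R) : 0 < e -> exists A : nat -> set bH,
  [/\ forall k, measurable (A k), trivIset setT A, \bigcup_k A k = setT &
   forall k (q q' : H), A k q -> A k q' -> mdist q q' <= e].
Proof.
move=> e0; have e20 : 0 < e / 2 by rewrite divr_gt0.
pose B k : set bH := if unpickle k is Some r then
  [set q | mdist (rational_point r) q < e / 2] else set0.
have mB k : measurable (B k).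
  rewrite /B; case: (unpickle k) => // r.
  by apply: sub_sigma_algebra; exact: open_mdist_ball.
exists (seqDU B); split.
- exact: seqDU_measurable.
- exact: trivIset_seqDU.
- rewrite -seqDU_bigcup_eq; apply/seteqP; split => // q _.
  have [r hr] := rational_point_dense q e20.
  by exists (pickle r) => //; rewrite /B pickleK/= metric_sym.
- move=> k q q' [+ _] [+ _]; rewrite /B; case: (unpickle k) => //= r h h'.
  apply: le_trans (metric_triangle _ (rational_point r) _) _.
  by rewrite metric_sym; lra.
Qed.

End Cells.

(** * The defect in norm *)

Section IntegratedDefect.
Context {R : realType} {n : nat}.
Local Notation H := (heis R n).
Local Notation bH := (borel H).
Variables (p : R) (p1 : 1 < p).
Local Open Scope ereal_scope.

Let p0 : (0 < p)%R. Proof. exact: lt_trans ltr01 p1. Qed.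

Lemma integral_excess_le (eta K : R) d (T : measurableType d)
    (G : probability T R) (f g r h : T -> R) :
  measurable_fun [set: T] f -> measurable_fun [set: T] g ->
  measurable_fun [set: T] r -> measurable_fun [set: T] h ->
  (forall w, 0 <= r w)%R -> (0 <= eta)%R -> (0 <= K)%R ->
  (forall w, h w `^ p <= eta * (f w `^ p + g w `^ p) +
    K * (f w `^ p + g w `^ p - 2 * (r w / 2) `^ p))%R ->
  \int[G]_w (h w `^ p)%:E +
    (2 * K * 2^-1 `^ p)%:E * \int[G]_w (r w `^ p)%:E <=
  (eta + K)%:E * (\int[G]_w (f w `^ p)%:E + \int[G]_w (g w `^ p)%:E).
Proof.
move=> mf mg mr mh r0 eta0 K0 fgrh.
have mpf := measurable_powR_EFin p mf.
have mpg := measurable_powR_EFin p mg.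
have mpr := measurable_powR_EFin p mr.
have mph := measurable_powR_EFin p mh.
have k0 : (0 <= 2 * K * 2^-1 `^ p)%R by rewrite !mulr_ge0 ?powR_ge0.
have pos (u : T -> R) : forall w, [set: T] w -> 0 <= (u w `^ p)%:E.
  by move=> w _; rewrite lee_fin powR_ge0.
rewrite -(ge0_integralZl_EFin _ _ (pos r))//.
rewrite -(ge0_integralD _ _ (pos h))//; last 2 first.
- by move=> w _; rewrite mule_ge0 ?lee_fin ?powR_ge0.
- exact: measurable_funeM.
rewrite -(ge0_integralD _ _ (pos f) _ (pos g))//.
rewrite -ge0_integralZl_EFin//; last 3 first.
- by move=> w _; rewrite adde_ge0// lee_fin powR_ge0.
- exact: emeasurable_funD.
- exact: addr_ge0.
apply: ge0_le_integral => //.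
- by move=> w _; rewrite adde_ge0 ?mule_ge0 ?lee_fin ?powR_ge0.
- by apply: emeasurable_funD => //; exact: measurable_funeM.
- by apply: measurable_funeM; exact: emeasurable_funD.
- move=> w _; rewrite /= -!(EFinM, EFinD) lee_fin.
  have := fgrh w; rewrite (powRM p (r0 w)) ?invr_ge0//; lra.
Qed.

(** The pointwise bound of [h] is integrated at the scale [tau]; the two terms in
    [K] cancel up to [c `^ p - C `^ p], as the norm of [r] is bounded below. *)
Lemma lpnorm_excess_le (eta K C c z tau : R) d (T : measurableType d)
    (G : probability T R) (f g r h : T -> R) :
  measurable_fun [set: T] f -> measurable_fun [set: T] g ->
  measurable_fun [set: T] r -> measurable_fun [set: T] h ->
  (forall w, 0 <= f w)%R -> (forall w, 0 <= g w)%R ->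
  (forall w, 0 <= r w)%R -> (forall w, 0 <= h w)%R ->
  (0 <= eta)%R -> (0 <= K)%R -> (0 <= C)%R -> (0 <= c)%R -> (0 <= z)%R ->
  (0 <= tau)%R ->
  (forall w, h w `^ p <= eta * (f w `^ p + g w `^ p) +
    K * (f w `^ p + g w `^ p - 2 * (r w / 2) `^ p))%R ->
  (2 * (eta * c `^ p + K * (c `^ p - C `^ p)) <= z `^ p)%R ->
  lpnorm p G f <= (c * tau)%:E -> lpnorm p G g <= (c * tau)%:E ->
  (2 * (C * tau))%:E <= lpnorm p G r -> lpnorm p G h <= (z * tau)%:E.
Proof.
move=> mf mg mr mh f0 g0 r0 h0 eta0 K0 C0 c0 z0 t0 fgrh hz.
have Ct : (0 <= 2 * (C * tau))%R by rewrite !mulr_ge0.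
rewrite !(lpnorm_le p1) ?(lpnorm_ge p1)// ?mulr_ge0//.
have := integral_excess_le G mf mg mr mh r0 eta0 K0 fgrh.
set I := \int[G]_w (h w `^ p)%:E; set I1 := \int[G]_w (f w `^ p)%:E.
set I2 := \int[G]_w (g w `^ p)%:E; set I3 := \int[G]_w (r w `^ p)%:E.
move: I I1 I2 I3 => I I1 I2 I3 main h1 h2 h3.
have kk0 : (0 <= 2 * K * 2^-1 `^ p)%R by rewrite !mulr_ge0 ?powR_ge0.
have eK0 : (0 <= eta + K)%R by rewrite addr_ge0.
have {main} : I + (2 * K * 2^-1 `^ p * (2 * (C * tau)) `^ p)%:E <=
  ((eta + K) * ((c * tau) `^ p + (c * tau) `^ p))%:E.
  apply: le_trans (le_trans main _).
    by rewrite leeD2l// EFinM lee_wpmul2l.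
  by rewrite EFinM lee_wpmul2l// EFinD leeD.
rewrite -leeBrDr// => /le_trans; apply; rewrite -EFinB lee_fin !powRM ?mulr_ge0//.
have -> : (2^-1 `^ p = (2 `^ p)^-1 :> R)%R.
  by rewrite -[X in (X `^ p)%R](@powR_inv1 R 2)// -powRrM mulN1r powRN.
have two : (2 `^ p != 0 :> R)%R by rewrite gt_eqF// powR_gt0.
rewrite [X in (_ - X <= _)%R](_ : _ = 2 * K * (C `^ p * tau `^ p))%R; last first.
  by field.
have : (tau `^ p * (2 * (eta * c `^ p + K * (c `^ p - C `^ p)))
   <= tau `^ p * z `^ p)%R by rewrite ler_wpM2l ?powR_ge0.
lra.
Qed.

(** This integrates [defect_powR]: [eta] is chosen from [z], and [de] from the
    constant [K] that comes with [eta]. By homogeneity neither depends on the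
    scale [tau]. *)
Lemma lpnorm_defect_small (C z : R) : (0 < C)%R -> (0 < z)%R ->
  exists2 de : R, (0 < de)%R & forall d (T : measurableType d)
    (G : probability T R) (X1 X2 X3 : T -> bH) (tau : R),
  measurable_fun [set: T] X1 -> measurable_fun [set: T] X2 ->
  measurable_fun [set: T] X3 -> (0 < tau)%R ->
  lpnorm p G (fun w => @mdist R H (X1 w) (X2 w)) <= ((C + de) * tau)%:E ->
  lpnorm p G (fun w => @mdist R H (X2 w) (X3 w)) <= ((C + de) * tau)%:E ->
  (2 * (C * tau))%:E <= lpnorm p G (fun w => @mdist R H (X1 w) (X3 w)) ->
  lpnorm p G (fun w => defect (X1 w) (X2 w) (X3 w)) <= (z * tau)%:E.
Proof.
move=> C0 z0.
have zp : (0 < z `^ p)%R by exact: powR_gt0.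
have C1p : (0 < (C + 1) `^ p)%R by rewrite powR_gt0// addr_gt0.
pose eta := (z `^ p / (4 * (C + 1) `^ p))%R.
have eta0 : (0 < eta)%R by rewrite divr_gt0// mulr_gt0.
have [K K0 hK] := @defect_powR R n p p1 eta eta0.
pose k := (z `^ p / (4 * (K + 1)))%R.
have k0 : (0 < k)%R by rewrite divr_gt0// mulr_gt0// ltr_wpDl.
pose C' := ((C `^ p + k) `^ p^-1)%R.
have C'p : (C' `^ p = C `^ p + k)%R.
  rewrite -powRrM mulVf ?gt_eqF// powRr1// addr_ge0 ?powR_ge0//.
  exact: ltW.
have CC' : (C < C')%R.
  rewrite ltNge; apply/negP => C'C.
  have := powR_mono p1 (powR_ge0 _ _ : 0 <= C')%R C'C.
  by rewrite C'p; lra.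
pose de := Num.min 1%R (C' - C)%R.
have de0 : (0 < de)%R by rewrite lt_min ltr01 subr_gt0.
have Cd0 : (0 <= C + de)%R by rewrite addr_ge0// ltW.
exists de => // d T G X1 X2 X3 tau m1 m2 m3 tau0.
apply: (@lpnorm_excess_le eta K C (C + de) z tau _ _ _
  (fun w => @mdist R H (X1 w) (X2 w)) (fun w => @mdist R H (X2 w) (X3 w))
  (fun w => @mdist R H (X1 w) (X3 w)) _ (measurable_mdist m1 m2)
  (measurable_mdist m2 m3) (measurable_mdist m1 m3)
  (measurable_defect m1 m2 m3) (fun=> mdist_ge0 _ _) (fun=> mdist_ge0 _ _)
  (fun=> mdist_ge0 _ _) (fun=> defect_ge0 _ _ _) (ltW eta0) K0 (ltW C0) Cd0
  (ltW z0) (ltW tau0) (fun w => hK (X1 w) (X2 w) (X3 w))).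
have h1 : ((C + de) `^ p <= C `^ p + k)%R.
  rewrite -C'p; apply: powR_mono => //.
  by rewrite addrC -lerBrDr ge_min lexx orbT.
have h2 : ((C + de) `^ p <= (C + 1) `^ p)%R.
  by apply: powR_mono => //; rewrite lerD2l ge_min lexx.
have h3 : (eta * (C + 1) `^ p = z `^ p / 4)%R.
  by rewrite /eta; field; rewrite gt_eqF.
have h4 : (K * k <= z `^ p / 4)%R.
  rewrite /k (_ : K * _ = (K / (K + 1)) * (z `^ p / 4))%R; last first.
    by field; rewrite gt_eqF// ltr_wpDl.
  rewrite ler_piMl//; first by rewrite divr_ge0// ltW.
  by rewrite ler_pdivrMr ?mul1r ?lerDl// ltr_wpDl.
have h5 : (eta * (C + de) `^ p <= z `^ p / 4)%R.
  by rewrite -h3 ler_wpM2l// ltW.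
have h6 : (K * ((C + de) `^ p - C `^ p) <= z `^ p / 4)%R.
  apply: le_trans h4; rewrite ler_wpM2l//; lra.
lra.
Qed.

End IntegratedDefect.

(** * The speed of the horizontal mean *)

Section MeanSpeed.
Context {R : realType} {n : nat}.
Local Notation H := (heis R n).
Local Notation bH := (borel H).
Variables (p : R) (p1 : 1 < p).
Implicit Types (mu nu : probability bH R).
Local Open Scope ereal_scope.

Let p0 : (0 < p)%R. Proof. exact: lt_trans ltr01 p1. Qed.

Let pairdist (w : bH * bH) : R := @mdist R H w.1 w.2.

Let measurable_pairdist : measurable_fun [set: bH * bH] pairdist.
Proof. by apply: measurable_mdist. Qed.

Let pairdist_ge0 w : (0 <= pairdist w)%R. Proof. exact: mdist_ge0. Qed.

Lemma optimal_cost_le_lpnorm d (T : measurableType d) (G : probability T R)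
    (X Y : T -> bH) mu nu c : has_law G X mu -> has_law G Y nu -> (0 <= c)%R ->
  optimal_cost p mu nu = (c `^ p)%:E ->
  c%:E <= lpnorm p G (fun w => @mdist R H (X w) (Y w)).
Proof.
move=> lX lY c0 oE; rewrite (lpnorm_ge p1)//; last by move=> w; exact: mdist_ge0.
by rewrite -oE; exact: optimal_cost_le.
Qed.

(** The two copies of the middle point lie in the same small cell, so replacing
    one by the other costs at most [e]. *)
Lemma coupling_gluing mu1 mu2 mu3 P Q (a b e : R) :
  coupling mu1 mu2 P -> coupling mu2 mu3 Q ->
  lpnorm p P pairdist <= a%:E -> lpnorm p Q pairdist <= b%:E -> (0 < e)%R ->
  exists G : probability ((bH * bH) * (bH * bH))%type R,
  [/\ has_law G (fun w => w.1.1) mu1, has_law G (fun w => w.1.2) mu2,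
      has_law G (fun w => w.2.2) mu3,
      lpnorm p G (fun w => @mdist R H w.1.1 w.1.2) <= a%:E &
      lpnorm p G (fun w => @mdist R H w.1.2 w.2.2) <= (e + b)%:E].
Proof.
move=> cP cQ Pa Qb e0; have ee0 : (0 <= e)%R by exact: ltW.
have [lP1 lP2] := coupling_has_law cP; have [lQ1 lQ2] := coupling_has_law cQ.
have [A [mA tA cA dA]] := @small_cells R n e e0.
have PQ : eq_meas (pushforward P snd) (pushforward Q fst).
  by move=> B mB; rewrite lP2.2// lQ1.2.
have [G [GP GQ GN]] := partition_gluing mA tA cA PQ.
have l1 : has_law G fst P by split.
have l2 : has_law G snd Q by split.
exists G; split.
- exact: has_law_comp l1 lP1.
- exact: has_law_comp l1 lP2.
- exact: has_law_comp l2 lQ2.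
- by rewrite (has_law_lpnorm p l1 measurable_pairdist).
have m12 : measurable_fun [set: (bH * bH) * (bH * bH)] (fun w => w.1.2).
  by apply: measurableT_comp.
have m21 : measurable_fun [set: (bH * bH) * (bH * bH)] (fun w => w.2.1).
  by apply: measurableT_comp.
have m22 : measurable_fun [set: (bH * bH) * (bH * bH)] (fun w => w.2.2).
  by apply: measurableT_comp.
have md := measurable_mdist m12 m21.
have hQ : lpnorm p G (fun w => @mdist R H w.2.1 w.2.2) <= b%:E.
  by rewrite (has_law_lpnorm p l2 measurable_pairdist).
have hd : lpnorm p G (fun w => @mdist R H w.1.2 w.2.1) <= e%:E.
  rewrite (lpnorm_le p1)//; last by move=> w; exact: mdist_ge0.
  rewrite -[leRHS](integral_cst_probability G).
  apply: ae_ge0_le_integral => //.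
  - by move=> w _; rewrite lee_fin powR_ge0.
  - exact: measurable_powR_EFin.
  - by move=> w _; rewrite lee_fin powR_ge0.
  exists [set w | (e < @mdist R H w.1.2 w.2.1)%R]; split.
  - rewrite (_ : [set _ | _] = setT `&`
      (fun w => @mdist R H w.1.2 w.2.1) @^-1` `]e, +oo[%classic).
      by apply: md => //; exact: measurable_itv.
    by rewrite setTI; apply/seteqP; split => w; rewrite /= in_itv/= andbT.
  - by apply: GN => k w /= ew Aw1 Aw2; have := dA k _ _ Aw1 Aw2; rewrite leNgt ew.
  - move=> w /= /existsNP[_ /negP]; rewrite lee_fin -ltNge => h.
    rewrite ltNge; apply/negP => hle; move: h; rewrite ltNge => /negP; apply.
    by apply: powR_mono => //; exact: mdist_ge0.
apply: le_trans (lpnormD p1 md (measurable_mdist m21 m22) hd hQ).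
apply: (lpnorm_mono p1).
- exact: measurable_mdist.
- by apply: measurable_funD => //; exact: measurable_mdist.
- by move=> w; rewrite mdist_ge0 metric_triangle.
Qed.

(** Near-optimal couplings of the two halves of a geodesic, glued, have small
    defect. The defect bounds the second difference of the horizontal parts, whose
    expectation is the second difference of the means. *)
Lemma hmean_midpoint mu1 mu2 mu3 (C tau : R) : (0 < C)%R -> (0 < tau)%R ->
  Wp p mu1 -> Wp p mu2 -> Wp p mu3 ->
  optimal_cost p mu1 mu2 = ((C * tau) `^ p)%:E ->
  optimal_cost p mu2 mu3 = ((C * tau) `^ p)%:E ->
  optimal_cost p mu1 mu3 = ((2 * (C * tau)) `^ p)%:E ->
  (hmean mu2 - hmean mu1 = hmean mu3 - hmean mu2)%R.
Proof.
move=> C0 tau0 W1 W2 W3 o12 o23 o13.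
set e := (hmean mu2 - hmean mu1 - (hmean mu3 - hmean mu2))%R.
suff : enorm e = 0%R by move=> /enorm0_eq0/eqP; rewrite subr_eq0 => /eqP.
apply/eqP; rewrite eq_le enorm_ge0 andbT; apply/ler_addgt0Pr => z z0.
rewrite add0r; have zt0 : (0 < z / tau)%R by rewrite divr_gt0.
have [de de0 hde] := @lpnorm_defect_small R n p p1 C _ C0 zt0.
have Ct0 : (0 <= C * tau)%R by rewrite mulr_ge0// ltW.
have lt1 : (C * tau < (C + de) * tau)%R by rewrite ltr_pM2r// ltrDl.
have lt2 : (C * tau < (C + de / 2) * tau)%R by rewrite ltr_pM2r// ltrDl divr_gt0.
have e0 : (0 < de / 2 * tau)%R by rewrite mulr_gt0// divr_gt0.
have [P cP hP] := optimal_cost_near p1 Ct0 lt1 o12.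
have [Q cQ hQ] := optimal_cost_near p1 Ct0 lt2 o23.
have [G [l1 l2 l3 h12]] := coupling_gluing cP cQ hP hQ e0.
rewrite (_ : _ + _ = (C + de) * tau)%R; last by field.
move=> h23.
have h13 := optimal_cost_le_lpnorm l1 l3 (mulr_ge0 (ler0n _ 2) Ct0) o13.
have := hde _ _ G _ _ _ tau l1.1 l2.1 l3.1 tau0 h12 h23 h13.
rewrite divfK ?gt_eqF// => hD.
have E := expectsB
  (expectsB (has_law_expects p1 l2 W2) (has_law_expects p1 l1 W1))
  (expectsB (has_law_expects p1 l3 W3) (has_law_expects p1 l2 W2)).
apply: (expects_le p1 E (measurable_defect l1.1 l2.1 l3.1) _ z0 hD).
by move=> w; rewrite /defect lerDl subr_ge0 enorm_hpi_le.
Qed.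

End MeanSpeed.

Section MeanGrowth.
Context {R : realType} {n : nat}.
Local Notation H := (heis R n).
Local Notation bH := (borel H).
Variables (p : R) (p1 : 1 < p).
Local Open Scope ereal_scope.

Let p0 : (0 < p)%R. Proof. exact: lt_trans ltr01 p1. Qed.

(** By Fubini's theorem, if all sections were larger then so would be the whole
    function. *)
Lemma lpnorm_section d d' (T : measurableType d) (T' : measurableType d')
    (P : probability T R) (Q : probability T' R) (f : T * T' -> R) (c c' : R) :
  measurable_fun [set: T * T'] f -> (forall w, 0 <= f w)%R -> (0 <= c)%R ->
  (c < c')%R -> lpnorm p (P \x Q) f <= c%:E ->
  exists x, lpnorm p Q (fun y => f (x, y)) <= c'%:E.
Proof.
move=> mf f0 c0 cc'; have c'0 : (0 <= c')%R by exact: le_trans (ltW cc').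
rewrite (lpnorm_le p1)// => fc; apply: contrapT => /forallNP nx.
have mpf := measurable_powR_EFin p mf.
have pf0 w : 0 <= (f w `^ p)%:E by rewrite lee_fin powR_ge0.
have : (c' `^ p)%:E <= (c `^ p)%:E.
  apply: le_trans fc; rewrite (fubini_tonelli1 _ mpf pf0).
  rewrite -[leLHS](integral_cst_probability P).
  apply: ge0_le_integral => //.
  - by move=> x _; rewrite lee_fin powR_ge0.
  - exact: measurable_fun_fubini_tonelli_F.
  - move=> x _; have /negP := nx x; rewrite -ltNge => /ltW.
    by rewrite (lpnorm_ge p1).
rewrite lee_fin leNgt => /negP; apply.
by apply: gt0_ltr_powR; rewrite ?nnegrE.
Qed.

Lemma has_law_fst d d' (T : measurableType d) (T' : measurableType d')
    (P : probability T R) (Q : probability T' R) : has_law (P \x Q) fst P.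
Proof.
split=> // A mA; rewrite /pushforward -[fst @^-1` A]setTI.
rewrite (_ : _ `&` _ = A `*` setT); last first.
  by apply/seteqP; split => -[x y]/=; tauto.
apply: etrans (product_measure1E P Q mA measurableT) _.
by rewrite -[RHS]mule1; congr (_ * _); exact: probability_setT.
Qed.

Lemma has_law_snd d d' (T : measurableType d) (T' : measurableType d')
    (P : probability T R) (Q : probability T' R) : has_law (P \x Q) snd Q.
Proof.
split=> // A mA; rewrite /pushforward -[snd @^-1` A]setTI.
rewrite (_ : _ `&` _ = setT `*` A); last first.
  by apply/seteqP; split => -[x y]/=; tauto.
apply: etrans (product_measure1E P Q measurableT mA) _.
by rewrite -[RHS]mul1e; congr (_ * _); exact: probability_setT.
Qed.

Lemma displacement_le (x1 x2 x2' x3 : H) :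
  (enorm (hpi x3 - hpi x2' - (hpi x2 - hpi x1)) <=
   defect x1 x2 x3 + mdist x2 x2')%R.
Proof.
have h1 := enorm_hpi_le x2' x2; have h2 := enorm_hpi_le x2 x3.
rewrite /defect; move: h1 h2; rewrite metric_sym.
set u := (hpi x2 - hpi x1)%R.
have -> : (hpi x3 - hpi x2' - u =
    - (u - (hpi x3 - hpi x2)) + (hpi x2 - hpi x2'))%R.
  by rewrite (opprB u) [RHS]addrAC [in RHS]addrA subrK.
have := enormD (- (u - (hpi x3 - hpi x2))) (hpi x2 - hpi x2').
rewrite enormN; lra.
Qed.

Lemma mdist_le_displacement (x1 x2 x2' x3 : H) : (mdist x2' x3 <=
  defect x1 x2 x3 + mdist x2 x2' + enorm (hpi x2 - hpi x1))%R.
Proof.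
rewrite /defect; set u := (hpi x2 - hpi x1)%R; set v := (hpi x3 - hpi x2)%R.
have := metric_triangle x2' x2 x3; rewrite (metric_sym x2' x2).
have := enormB u (u - v); rewrite (opprB u) addrC subrK.
lra.
Qed.

(** Couple the backward and the forward half of a geodesic centred at [mu]
    independently: the total distance is still at least [2 C T] in norm, while the
    mismatch at the centre does not depend on [T], so the defect is small compared
    with [T]. By independence, fixing a typical backward pair gives a fixed vector
    [u] to which the forward displacement is close in norm. *)
Lemma hmean_growth (C z : R) (mu : probability bH R) : (0 < C)%R -> (0 < z)%R ->
  Wp p mu -> exists T0 : R, forall (T : R) (mu1 mu3 : probability bH R),
  (T0 <= T)%R -> (0 < T)%R -> Wp p mu1 -> Wp p mu3 ->
  optimal_cost p mu1 mu = ((C * T) `^ p)%:E ->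
  optimal_cost p mu mu3 = ((C * T) `^ p)%:E ->
  optimal_cost p mu1 mu3 = ((2 * (C * T)) `^ p)%:E ->
  (C * T <= enorm (hmean mu3 - hmean mu) + z * T)%R.
Proof.
move=> C0 z0 Wmu; pose s := (z / 6)%R.
have s0 : (0 < s)%R by rewrite divr_gt0.
have [de de0 hde] := @lpnorm_defect_small R n p p1 C s C0 s0.
have [c c0 hc] := Wp_lpnorm p1 (horizontal 0 0) Wmu.
have md0 : measurable_fun [set: bH] (fun q => @mdist R H q (horizontal 0 0)).
  by apply: measurable_mdist => //; exact: measurable_cst.
pose k := Num.min (de / 2)%R s.
have k0 : (0 < k)%R by rewrite lt_min s0 divr_gt0.
exists (2 * c / k)%R => T mu1 mu3 T0T T0 W1 W3 o1 o3 o13.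
have ckT : (2 * c <= k * T)%R by rewrite [leRHS]mulrC -ler_pdivrMr.
have cdT : (c + c <= de / 2 * T)%R.
  rewrite (_ : c + c = 2 * c)%R; last by ring.
  apply: le_trans ckT _.
  by rewrite ler_wpM2r ?(ltW T0)// ge_min lexx.
have cdT' : (c + c + (C + de / 2) * T <= (C + de) * T)%R by lra.
have csT : (c + c <= s * T)%R.
  rewrite (_ : c + c = 2 * c)%R; last by ring.
  apply: le_trans ckT _.
  by rewrite ler_wpM2r ?(ltW T0)// ge_min lexx orbT.
have CT0 : (0 <= C * T)%R by apply: mulr_ge0; exact: ltW.
have lt1 : (C * T < (C + de) * T)%R by rewrite ltr_pM2r// ltrDl.
have lt2 : (C * T < (C + de / 2) * T)%R by rewrite ltr_pM2r// ltrDl divr_gt0.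
have [P cP hP] := optimal_cost_near p1 CT0 lt1 o1.
have [Q cQ hQ] := optimal_cost_near p1 CT0 lt2 o3.
have [lP1 lP2] := coupling_has_law cP; have [lQ2 lQ3] := coupling_has_law cQ.
pose G : probability ((bH * bH) * (bH * bH))%type R := P \x Q.
have lGP : has_law G fst P by exact: has_law_fst.
have lGQ : has_law G snd Q by exact: has_law_snd.
have l1 := has_law_comp lGP lP1; have l2 := has_law_comp lGP lP2.
have l2' := has_law_comp lGQ lQ2; have l3 := has_law_comp lGQ lQ3.
have mpd : measurable_fun [set: bH * bH] (fun w => @mdist R H w.1 w.2).
  exact: measurable_mdist.
have pd0 (w : bH * bH) : (0 <= @mdist R H w.1 w.2)%R by exact: mdist_ge0.
have d00 (q : bH) : (0 <= @mdist R H q (horizontal 0 0))%R by exact: mdist_ge0.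
have h12 : lpnorm p G (fun w => @mdist R H w.1.1 w.1.2) <= ((C + de) * T)%:E.
  by rewrite (has_law_lpnorm p lGP mpd pd0).
have h2'3 : lpnorm p G (fun w => @mdist R H w.2.1 w.2.2) <=
    ((C + de / 2) * T)%:E.
  by rewrite (has_law_lpnorm p lGQ mpd pd0).
have m22' := measurable_mdist l2.1 l2'.1.
have h22' : lpnorm p G (fun w => @mdist R H w.1.2 w.2.1) <= (c + c)%:E.
  have e1 : lpnorm p G (fun w => @mdist R H w.1.2 (horizontal 0 0)) <= c%:E.
    by rewrite (has_law_lpnorm p l2 md0 d00).
  have e2 : lpnorm p G (fun w => @mdist R H w.2.1 (horizontal 0 0)) <= c%:E.
    by rewrite (has_law_lpnorm p l2' md0 d00).
  have m1 : measurable_fun setT (fun w : (bH * bH) * (bH * bH) =>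
    @mdist R H w.1.2 (horizontal 0 0)) := measurableT_comp md0 l2.1.
  have m2 : measurable_fun setT (fun w : (bH * bH) * (bH * bH) =>
    @mdist R H w.2.1 (horizontal 0 0)) := measurableT_comp md0 l2'.1.
  apply: le_trans (lpnormD p1 m1 m2 e1 e2).
  apply: (lpnorm_mono p1); [exact: m22'|exact: (measurable_funD m1 m2)|move=> w].
  by rewrite mdist_ge0/= (metric_sym w.2.1) metric_triangle.
have h23 : lpnorm p G (fun w => @mdist R H w.1.2 w.2.2) <= ((C + de) * T)%:E.
  have : lpnorm p G (fun w => @mdist R H w.1.2 w.2.2) <=
      (c + c + (C + de / 2) * T)%:E.
    have m2'3 := measurable_mdist l2'.1 l3.1.
    apply: le_trans (lpnormD p1 m22' m2'3 h22' h2'3).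
    apply: (lpnorm_mono p1); [exact: measurable_mdist l2.1 l3.1|
      exact: (measurable_funD m22' m2'3)|move=> w].
    by rewrite mdist_ge0 metric_triangle.
  by move=> h; apply: le_trans h _; rewrite lee_fin.
have h13 := optimal_cost_le_lpnorm p1 l1 l3 (mulr_ge0 (ler0n _ 2) CT0) o13.
have hD := hde _ _ G _ _ _ T l1.1 l2.1 l3.1 T0 h12 h23 h13.
have mD := measurable_defect l1.1 l2.1 l3.1.
pose f (w : (bH * bH) * (bH * bH)) : R :=
  (defect (w.1.1 : H) w.1.2 w.2.2 + @mdist R H w.1.2 w.2.1)%R.
have mf : measurable_fun [set: (bH * bH) * (bH * bH)] f by exact: measurable_funD.
have f0 w : (0 <= f w)%R by rewrite addr_ge0 ?defect_ge0 ?mdist_ge0.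
have sT0 : (0 < s * T)%R by rewrite mulr_gt0.
have hf : lpnorm p G f <= (2 * (s * T))%:E.
  have h22s : lpnorm p G (fun w => @mdist R H w.1.2 w.2.1) <= (s * T)%:E.
    by apply: le_trans h22' _; rewrite lee_fin.
  rewrite (_ : 2 * (s * T) = s * T + s * T)%R; last by ring.
  have := lpnormD p1 mD m22' hD h22s. exact.
have c20 : (0 <= 2 * (s * T))%R by apply: mulr_ge0 => //; exact: ltW.
have c23 : (2 * (s * T) < 3 * (s * T))%R by rewrite ltr_pM2r// ltr_nat.
have [q0 hq0] := lpnorm_section mf f0 c20 c23 hf.
have mq0 : measurable_fun [set: bH * bH] (fun w => f (q0, w)).
  exact: measurableT_comp.
pose u := (hpi (q0.2 : H) - hpi (q0.1 : H))%R.
have c3 : (0 < 3 * (s * T))%R by rewrite mulr_gt0.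
(* The defect compares the displacements from [q0.2] with [u]; the distance
   from [q0.2] to [w.1] is the other term of [f]. *)
have hu (w : bH * bH) :
    (enorm (hpi (w.2 : H) - hpi (w.1 : H) - u) <= f (q0, w))%R.
  exact: displacement_le.
have hmu : (enorm (hmean mu3 - hmean mu - u) <= 3 * (s * T))%R.
  have E := expectsB (expectsB (has_law_expects p1 lQ3 W3)
    (has_law_expects p1 lQ2 Wmu)) (expects_cst Q u).
  exact: (expects_le p1 E mq0 hu c3 hq0).
have hCT : (C * T <= 3 * (s * T) + enorm u)%R.
  have u0 := enorm_ge0 u.
  rewrite -lee_fin; apply: le_trans (optimal_cost_le_lpnorm p1 lQ2 lQ3 CT0 o3) _.
  have hcu : lpnorm p Q (fun=> enorm u) <= (enorm u)%:E by rewrite lpnorm_cst.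
  have mcu : measurable_fun [set: bH * bH] (fun=> enorm u).
    exact: measurable_cst.
  apply: le_trans (lpnormD p1 mq0 mcu hq0 hcu).
  apply: (lpnorm_mono p1); [exact: mpd|
    exact: (measurable_funD mq0 mcu)|move=> w].
  by rewrite mdist_ge0; exact: mdist_le_displacement.
have := enormB (hmean mu3 - hmean mu) (hmean mu3 - hmean mu - u).
rewrite (opprB (hmean mu3 - hmean mu)%R) addrC subrK.
have sE : (s * T = z * T / 6)%R by rewrite /s; field.
move: hmu hCT; rewrite sE.
move: (enorm _) (enorm u) (enorm _) => x y w; clear; lra.
Qed.

End MeanGrowth.

(** * Displacements close to a horizontal vector *)

Section NearTranslate.
Context {R : realType} {n : nat}.
Local Notation H := (heis R n).
Implicit Types (q : H) (a b : 'rV[R]_n).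

(** The horizontal error is bounded by polarisation. The vertical part of the
    displacement is small because the horizontal part almost exhausts its length,
    and replacing the base point [q] by its translate only adds the symplectic
    product of [W] with the horizontal error. *)
Lemma near_translate a b q q' (k : R) : let W := row_mx a b in
  0 < k -> k <= 4^-1 ->
  `|mdist q q' - enorm W| <= k * enorm W ->
  mdist q q' * enorm W - dot W (hpi q' - hpi q) <= k * enorm W ^+ 2 ->
  mdist (heis_mul q (horizontal a b)) q' ^+ 4 <= 100 * k * enorm W ^+ 4.
Proof.
move=> W k0 k1; set qW := heis_mul q _; set u := hpi q' - hpi q.
have hqW : hpi qW - hpi q = W.
  by rewrite hpi_right_translation (addrC (hpi q)) addrK.
have huW : hpi q' - hpi qW = u - W.
  by rewrite hpi_right_translation opprD addrA.
have hv : vert qW q' = vert q q' + 2 * dot W (quarter (u - W)).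
  rewrite (vert_cocycle q qW q') vert_right_translation hqW huW; ring.
rewrite mdist_pow4 huW hv -enorm_sq.
have := dot_normr_le W (quarter (u - W)); rewrite enorm_quarter.
have := enormB_sq u W; rewrite (dotC u W).
have := enorm_ge0 (u - W); have := enorm_ge0 W; have := enorm_ge0 u.
have := dot_le W u; have := enorm_hpi_le q q'; rewrite -/u.
have := mdist_pow4 q q'; rewrite -/u -enorm_sq.
have := @mdist_ge0 _ _ q q'.
move: (dot W (quarter _)) (enorm (u - W)) (enorm u) (enorm W) (dot W u)
  (vert q q') (mdist q q') => w e a' l s z d {hqW huW hv}.
move=> d0 dE ud sul a0 l0 e0 eE we dl ds.
have e2 : e ^+ 2 <= 3 * k * l ^+ 2.
  have h1 : (d - l) ^+ 2 <= (k * l) ^+ 2.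
    by rewrite -real_normK ?num_real// ler_pXn2r ?nnegrE// mulr_ge0// ltW.
  have h2 : a' ^+ 2 <= d ^+ 2 by rewrite ler_pXn2r ?nnegrE.
  have h3 : k ^+ 2 * l ^+ 2 <= k * l ^+ 2.
    by rewrite ler_wpM2r ?sqr_ge0// expr2 ler_piMl//; lra.
  rewrite eE; lra.
have w2 : w ^+ 2 <= 3 * k * l ^+ 4.
  apply: (@le_trans _ _ ((l * e) ^+ 2)).
    by rewrite -real_normK ?num_real// ler_pXn2r ?nnegrE ?mulr_ge0.
  rewrite exprMn (_ : 3 * k * l ^+ 4 = l ^+ 2 * (3 * k * l ^+ 2)); last by ring.
  by rewrite ler_wpM2l ?sqr_ge0.
have z2 : z ^+ 2 <= 23 * k * l ^+ 4.
  have dle : d <= (1 + k) * l by move: dl; rewrite ler_norml => /andP[]; lra.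
  have dge : (1 - k) * l <= d by move: dl; rewrite ler_norml => /andP[]; lra.
  have ale : (1 - 2 * k) * l <= a'.
    have [l00|lN0] := eqVneq l 0; first by rewrite l00 mulr0.
    have lp : 0 < l by rewrite lt_neqAle eq_sym lN0.
    rewrite -(ler_pM2l lp); nra.
  have d4 : d ^+ 4 <= ((1 + k) * l) ^+ 4.
    rewrite ler_pXn2r ?nnegrE// mulr_ge0//; lra.
  have a4 : ((1 - 2 * k) * l) ^+ 4 <= a' ^+ 4.
    rewrite ler_pXn2r ?nnegrE// mulr_ge0//; lra.
  have l4 : 0 <= l ^+ 4 by rewrite exprn_ge0.
  have k4 : (1 + k) ^+ 4 - (1 - 2 * k) ^+ 4 <= 23 * k.
    have k3 : 0 <= k ^+ 3 by rewrite exprn_ge0// ltW.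
    have k2 : k ^+ 2 <= k * 4^-1 by rewrite expr2 ler_wpM2l// ltW.
    have k33 : k ^+ 3 <= k ^+ 2 * 4^-1 by rewrite exprSr ler_wpM2l// sqr_ge0.
    have k44 : 0 <= k ^+ 4 by rewrite exprn_ge0// ltW.
    rewrite (_ : _ - _ = 12 * k - 18 * k ^+ 2 + 36 * k ^+ 3 - 15 * k ^+ 4);
      last by ring.
    lra.
  have : ((1 + k) ^+ 4 - (1 - 2 * k) ^+ 4) * l ^+ 4 <= 23 * k * l ^+ 4.
    by rewrite ler_wpM2r.
  move: d4 a4; rewrite dE (exprMn _ (1 + k)) (exprMn _ (1 - 2 * k)).
  rewrite (_ : (a' ^+ 2) ^+ 2 = a' ^+ 4); last by ring.
  lra.
have e4 : (e ^+ 2) ^+ 2 <= 9 * k * l ^+ 4.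
  apply: (@le_trans _ _ ((3 * k * l ^+ 2) ^+ 2)).
    rewrite ler_pXn2r ?nnegrE ?sqr_ge0// !mulr_ge0 ?sqr_ge0//; exact: ltW.
  have : k ^+ 2 * l ^+ 4 <= k * l ^+ 4.
    by rewrite ler_wpM2r ?exprn_ge0// expr2 ler_piMl//; lra.
  rewrite (_ : (3 * k * l ^+ 2) ^+ 2 = 9 * (k ^+ 2 * l ^+ 4)); last by ring.
  lra.
have : (z + 2 * w) ^+ 2 <= 2 * z ^+ 2 + 8 * w ^+ 2.
  have := sqr_ge0 (z - 2 * w); lra.
have : 0 <= k * l ^+ 4 by rewrite mulr_ge0 ?exprn_ge0// ltW.
lra.
Qed.

(** Away from the translate by [W], either the length differs from that of [W],
    and the power is strictly above its tangent line, or the displacement is not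
    aligned with [W], and its component along [W] is shorter than its length. *)
Lemma translate_gap (p : R) a b (e : R) : 1 < p -> 0 < e ->
  let W := row_mx a b in 0 < enorm W -> exists2 g, 0 < g &
  forall q q', e <= mdist (heis_mul q (horizontal a b)) q' ->
  enorm W `^ p + p * enorm W `^ (p - 1) *
    (dot W (hpi q' - hpi q) / enorm W - enorm W) + g <= mdist q q' `^ p.
Proof.
move=> p1 e0 W; set l := enorm W => l0.
pose k := Num.min 4^-1 (e ^+ 4 / (200 * l ^+ 4)).
have l4 : 0 < l ^+ 4 by rewrite exprn_gt0.
have k0 : 0 < k.
  by rewrite lt_min invr_gt0 ltr0n/= divr_gt0 ?exprn_gt0 ?mulr_gt0.
have k1 : k <= 4^-1 by rewrite ge_min lexx.
have ke : 100 * k * l ^+ 4 < e ^+ 4.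
  have : k * (200 * l ^+ 4) <= e ^+ 4.
    by rewrite -ler_pdivlMr ?mulr_gt0// ge_min lexx orbT.
  have : 0 < k * l ^+ 4 by rewrite mulr_gt0.
  lra.
have [g g0 hg] := bernoulli_gap p1 k0.
have lp : 0 < l `^ p by exact: powR_gt0.
have lp1 : l `^ p = l * l `^ (p - 1) by rewrite mulr_powRB1 ?(ltW l0)//; lra.
have l1 : 0 < l `^ (p - 1) by exact: powR_gt0.
pose m := Num.min (g * l `^ p) (p * k * l `^ p).
have m1 : m <= g * l `^ p by rewrite ge_min lexx.
have m2 : m <= p * k * l `^ p by rewrite ge_min lexx orbT.
exists m; first by rewrite lt_min !mulr_gt0//; lra.
move=> q q' far.
have d0 : 0 <= mdist q q' by exact: mdist_ge0.
have sd : dot W (hpi q' - hpi q) / l <= mdist q q'.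
  rewrite ler_pdivrMr// mulrC; apply: le_trans (dot_le _ _) _.
  by rewrite ler_wpM2l ?(ltW l0)// enorm_hpi_le.
set s := dot W _ / l in sd *.
have slope (x y : R) : x <= y -> p * l `^ (p - 1) * x <= p * l `^ (p - 1) * y.
  by move=> xy; rewrite ler_wpM2l// mulr_ge0 ?(ltW l1)//; lra.
have slope1 := slope (s - l) (mdist q q' - l) ltac:(lra).
have [away|near] := leP k `|mdist q q' / l - 1|.
  have := hg (mdist q q' / l) (divr_ge0 d0 (ltW l0)) away.
  rewrite -(ler_pM2l lp) => h.
  have E : l `^ p * (mdist q q' / l) `^ p = mdist q q' `^ p.
    by rewrite -powRM ?divr_ge0 ?(ltW l0)// mulrCA divff ?mulr1// gt_eqF.
  have F : l `^ p * (1 + p * (mdist q q' / l - 1) + g) =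
      l `^ p + p * l `^ (p - 1) * (mdist q q' - l) + g * l `^ p.
    by rewrite lp1; field; rewrite gt_eqF.
  by move: h; rewrite E F; lra.
have [short|aligned] := leP (k * l) (mdist q q' - s).
  have := powR_tangent p1 (ltW l0) d0.
  have := slope (k * l) _ short.
  have -> : p * l `^ (p - 1) * (k * l) = p * k * l `^ p by rewrite lp1; ring.
  lra.
exfalso; move: far; rewrite leNgt => /negP; apply.
rewrite -(@ltr_pXn2r _ 4)// ?nnegrE ?mdist_ge0 ?(ltW e0)//.
apply: le_lt_trans ke; apply: near_translate => //.
  rewrite (_ : mdist q q' - _ = (mdist q q' / l - 1) * l); last first.
    by rewrite /l; field; rewrite gt_eqF.
  by rewrite normrM (gtr0_norm l0) ler_wpM2r// ltW.
have -> : dot W (hpi q' - hpi q) = s * l by rewrite /s divfK// gt_eqF.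
rewrite -/l -mulrBl expr2 mulrA ler_wpM2r//; exact: ltW.
Qed.

End NearTranslate.

(** * Laws with couplings close to the diagonal *)

Section EqualityInLaw.
Context {R : realType} {n : nat}.
Local Notation H := (heis R n).
Local Notation bH := (borel H).
Implicit Types (mu nu : probability bH R).
Local Open Scope ereal_scope.

Definition neighborhood (A : set H) (e : R) : set H :=
  \bigcup_(a in A) [set q | (mdist a q < e)%R].

Lemma measurable_neighborhood (A : set H) e :
  measurable (neighborhood A e : set bH).
Proof.
apply: sub_sigma_algebra; apply: bigcup_open => a _; exact: open_mdist_ball.
Qed.

Lemma closed_bigcap_neighborhood (A : set H) : closed A ->
  \bigcap_k neighborhood A (k.+1%:R^-1) = A.
Proof.
move=> cA; apply/seteqP; split => [q h|q Aq k _]; last first.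
  by exists q => //=; rewrite mdistxx invr_gt0.
apply: cA => B /nbhs_ballP[e /= e0 eB].
have [k ke] := ltr_add_invr e0.
have [a Aa /= aq] := h k I; exists a; split => //; apply: eB.
rewrite ballEmdist/= metric_sym; apply: lt_trans aq _.
by rewrite add0r in ke.
Qed.

(** Continuity from above along the shrinking neighborhoods of a closed set. *)
Lemma closed_le_neighborhood mu nu (A : set H) : closed A ->
  (forall e, (0 < e)%R -> mu A <= nu (neighborhood A e)) -> mu A <= nu A.
Proof.
move=> cA h; rewrite -[in leRHS](closed_bigcap_neighborhood cA).
pose F k := neighborhood A (k.+1%:R^-1) : set bH.
have mF k : measurable (F k) by exact: measurable_neighborhood.
have cvgF : nu (F k) @[k --> \oo] --> nu (\bigcap_k F k).
  apply: nonincreasing_cvg_mu => //.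
  - by rewrite ltey_eq fin_num_measure.
  - exact: bigcap_measurable.
  - move=> i j ij; apply/subsetPset => q [a Aa /= aq]; exists a => //=.
    by apply: lt_le_trans aq _; rewrite lef_pV2 ?posrE// ler_nat ltnS.
rewrite -(cvg_lim _ cvgF)//; apply: lime_ge; first by apply/cvg_ex; eexists; exact: cvgF.
by apply: nearW => k; apply: h; rewrite invr_gt0.
Qed.

Lemma closed_eq_meas mu nu : (forall A : set H, closed A -> mu A = nu A) ->
  eq_meas mu nu.
Proof.
move=> h A mA; apply: (@measure_unique _ R bH (@open H) (fun=> setT) _ _ _ _ mu nu) => //.
- exact: openI.
- by move=> _; exact: openT.
- by rewrite bigcup_const.
- move=> B oB; have mB : measurable (B : set bH) by exact: sub_sigma_algebra.
  have mBC : measurable (~` B : set bH) by exact: measurableC.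
  have := probability_setC mu mBC; have := probability_setC nu mBC.
  rewrite setCK (h _ (open_closedC oB)) => nuB muB.
  by apply: etrans muB _; exact: esym nuB.
- by move=> _; rewrite ltey_eq fin_num_measure.
Qed.

Lemma le_neighborhood mu nu d (T : measurableType d) (G : probability T R)
    (X Y : T -> bH) (A : set H) (e k : R) : measurable (A : set bH) ->
  has_law G X mu -> has_law G Y nu ->
  G [set w | (e <= @mdist R H (X w) (Y w))%R] <= k%:E ->
  mu A <= nu (neighborhood A e) + k%:E.
Proof.
move=> mA [mX lX] [mY lY] far; have mN := measurable_neighborhood A e.
have mXA : measurable (X @^-1` A) by rewrite -[X in measurable X]setTI; exact: mX.
have mYN : measurable (Y @^-1` neighborhood A e).
  by rewrite -[X in measurable X]setTI; exact: mY.
have mfar : measurable [set w | (e <= @mdist R H (X w) (Y w))%R].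
  rewrite (_ : [set _ | _] = setT `&`
    (fun w => @mdist R H (X w) (Y w)) @^-1` `[e, +oo[%classic).
    by apply: (measurable_mdist mX mY) => //; exact: measurable_itv.
  by rewrite setTI; apply/seteqP; split => w; rewrite /= in_itv/= andbT.
rewrite -(lX _ mA) -(lY _ mN) /pushforward.
apply: le_trans (leeD2l _ far).
apply: le_trans (measureU2 _ mYN mfar); apply: le_measure; rewrite ?inE//.
  exact: measurableU.
move=> w /= AX; have [near|far'] := ltP (@mdist R H (X w) (Y w)) e.
  by left; exists (X w).
by right.
Qed.

(** By [le_neighborhood], each law of a closed set is at most the other law of
    any neighborhood of it, up to an arbitrarily small exceptional mass. *)
Lemma close_couplings_eq mu nu :
  (forall e k : R, (0 < e)%R -> (0 < k)%R ->
    exists (d : measure_display) (T : measurableType d) (G : probability T R)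
      (X Y : T -> bH), [/\ has_law G X mu, has_law G Y nu &
        G [set w | (e <= @mdist R H (X w) (Y w))%R] <= k%:E]) ->
  eq_meas mu nu.
Proof.
move=> h; apply: closed_eq_meas => A cA.
have mA : measurable (A : set bH).
  rewrite -[A]setCK; apply: measurableC; apply: sub_sigma_algebra.
  exact: closed_openC.
apply/eqP; rewrite eq_le; apply/andP; split;
  apply: closed_le_neighborhood => // e e0; apply/lee_addgt0Pr => k k0;
  have [d [T [G [X [Y [lX lY far]]]]]] := h e k e0 k0.
  exact: le_neighborhood lX lY far.
apply: (le_neighborhood mA lY lX).
rewrite (_ : [set _ | _] = [set w | (e <= @mdist R H (X w) (Y w))%R])//.
by apply/seteqP; split => w /=; rewrite metric_sym.
Qed.

End EqualityInLaw.

(** * Rigidity of geodesics *)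

Section TranslationSemigroup.
Context {R : realType} {n : nat}.
Local Notation H := (heis R n).

Lemma heis_mul0 (q : H) : heis_mul q (horizontal 0 0) = q.
Proof.
case: q => x y z; rewrite /heis_mul/= !addr0 big1 => [|i _]; last first.
  by rewrite !mxE mul0r mulr0 subr0.
by rewrite mulr0 addr0.
Qed.

(** Along a fixed horizontal direction the translations form a one-parameter
    group: the symplectic term of the group law vanishes. *)
Lemma heis_mul_horizontal (q : H) (u v : 'rV[R]_n) (s t : R) :
  heis_mul (heis_mul q (horizontal (t *: u) (t *: v)))
    (horizontal ((s - t) *: u) ((s - t) *: v)) =
  heis_mul q (horizontal (s *: u) (s *: v)).
Proof.
rewrite /heis_mul/=; congr Heis.
- by rewrite -addrA -scalerDl (addrC t) subrK.
- by rewrite -addrA -scalerDl (addrC t) subrK.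
rewrite !addr0 -addrA -mulrDr -big_split/=; congr (_ + 2 * _).
by apply: eq_bigr => i _; rewrite !mxE; ring.
Qed.

End TranslationSemigroup.

Section Rigidity.
Context {R : realType} {n : nat}.
Local Notation H := (heis R n).
Local Notation bH := (borel H).
Variables (p : R) (p1 : 1 < p).
Implicit Types (mu nu : probability bH R) (a b : 'rV[R]_n).

Let p0 : 0 < p. Proof. exact: lt_trans ltr01 p1. Qed.

Local Notation translate nu a b :=
  (distribution nu (right_translation (horizontal a b))).

Lemma powR_tangent_dot (W : 'rV[R]_(n + n)) (q q' : H) : 0 < enorm W ->
  enorm W `^ p + p * enorm W `^ (p - 1) *
    (dot W (hpi q' - hpi q) / enorm W - enorm W) <= mdist q q' `^ p.
Proof.
move=> l0; apply: le_trans (powR_tangent p1 (ltW l0) (mdist_ge0 q q')).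
rewrite lerD2l ler_wpM2l ?mulr_ge0 ?powR_ge0 ?(ltW p0)// lerD2r.
rewrite ler_pdivrMr// mulrC; apply: le_trans (dot_le _ _) _.
by rewrite ler_wpM2l ?(ltW l0)// enorm_hpi_le.
Qed.

(** Equality in the lower bound of the cost by the means: the excess over the
    tangent line has small integral for near-optimal couplings, hence by Markov's
    inequality these couplings concentrate on the graph of the translation. *)
Lemma translate_of_optimal mu nu a b : Wp p mu -> Wp p nu ->
  row_mx a b = hmean nu - hmean mu -> 0 < enorm (row_mx a b) ->
  optimal_cost p mu nu = (enorm (row_mx a b) `^ p)%:E ->
  eq_meas (translate mu a b) nu.
Proof.
move=> Wmu Wnu WE l0 oE; apply: close_couplings_eq => e k e0 k0.
have [g g0 hg] := translate_gap p1 e0 l0.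
move: WE l0 oE hg; set W := row_mx a b; set l := enorm W => WE l0 oE hg.
have : (optimal_cost p mu nu < (l `^ p + g * k)%:E)%E.
  by rewrite oE lte_fin ltrDl mulr_gt0.
move=> /ereal_inf_lt[_ [Pi cPi <-]] hPi.
have [l1 l2] := coupling_has_law cPi.
exists _, _, Pi, (fun w => right_translation (horizontal a b) w.1), snd.
have lT := has_law_comp l1 (has_law_translate mu a b).
split=> //; set far := [set w | _].
have mfar : measurable far.
  rewrite (_ : far = setT `&` (fun w => @mdist R H
    (right_translation (horizontal a b) w.1) w.2) @^-1` `[e, +oo[%classic).
    by apply: (measurable_mdist lT.1 l2.1) => //; exact: measurable_itv.
  by rewrite setTI; apply/seteqP; split => w; rewrite /far /= in_itv/= andbT.
pose D (w : bH * bH) : R := @mdist R H w.1 w.2 `^ p.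
have mD : measurable_fun [set: bH * bH] D.
  by apply: measurable_fun_powR; exact: measurable_mdist.
have D0 w : 0 <= D w by exact: powR_ge0.
have iD : Pi.-integrable setT (EFin \o D).
  apply/integrableP; split; first exact/measurable_EFinP.
  under eq_integral do rewrite /= ger0_norm//.
  exact: lt_trans hPi (ltry _).
pose c := p * l `^ (p - 1) / l.
have [iS eS] := expects_dot W (expectsB (has_law_expects p1 l2 Wnu)
  (has_law_expects p1 l1 Wmu)).
pose L (w : bH * bH) : R := c * dot W (hpi (w.2 : H) - hpi (w.1 : H)).
have iL : Pi.-integrable setT (EFin \o L).
  rewrite (_ : _ \o _ = (fun w => c%:E *
    (dot W (hpi ((w : bH * bH).2 : H) - hpi (w.1 : H)))%:E)%E)//.
  exact: integrableZl.
pose k1 : R := (p - 1) * l `^ p.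
have iK : Pi.-integrable setT (EFin \o cst k1).
  exact: finite_measure_integrable_cst.
pose h w := D w - L w + k1.
have iDL : Pi.-integrable setT (EFin \o (fun w => D w - L w)).
  rewrite (_ : _ \o _ = (fun w => (D w)%:E - (L w)%:E)%E)//.
  exact: integrableB.
have ih : Pi.-integrable setT (EFin \o h).
  rewrite (_ : _ \o _ = (fun w => (D w - L w)%:E + k1%:E)%E)//.
  exact: integrableD.
have lpE : l `^ p = l * l `^ (p - 1) by rewrite mulr_powRB1 ?(ltW l0).
have hE w : h w = D w - (l `^ p + p * l `^ (p - 1) *
    (dot W (hpi (w.2 : H) - hpi (w.1 : H)) / l - l)).
  by rewrite /h /L /c /k1 lpE; field; rewrite gt_eqF.
have h0 w : 0 <= h w.
  by rewrite hE subr_ge0; exact: powR_tangent_dot.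
have hfar w : far w -> g <= h w.
  by move=> fw; have := hg w.1 w.2 fw; rewrite hE /D; lra.
have hint : \int[Pi]_w h w < g * k.
  rewrite RintegralD// RintegralB// RintegralZl// eS -WE -enorm_sq -/l.
  rewrite {2}/Rintegral integral_cst_probability/=.
  rewrite -lte_fin in hPi *; apply: contraTT hPi; rewrite -!leNgt => hPi.
  have -> : cost p Pi = (\int[Pi]_w D w)%:E.
    by rewrite /Rintegral fineK//; exact: integrable_fin_num.
  move: hPi; rewrite !lee_fin /c /k1 lpE.
  have -> : p * l `^ (p - 1) / l * l ^+ 2 = p * (l * l `^ (p - 1)).
    by field; rewrite gt_eqF.
  lra.
have key : (g%:E * Pi far <= g%:E * k%:E)%E.
  have mEh : measurable_fun [set: bH * bH] (EFin \o h) by exact: measurable_int ih.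
  rewrite -EFinM -(integral_cst Pi mfar g%:E).
  apply: (@le_trans _ _ (\int[Pi]_(w in far) (h w)%:E)%E).
    apply: ge0_le_integral => //.
    - by move=> w _; rewrite lee_fin ltW.
    - exact: measurable_funTS.
  apply: (@le_trans _ _ (\int[Pi]_w (h w)%:E)%E).
    by apply: ge0_subset_integral => // w _; rewrite lee_fin.
  rewrite -(fineK (integrable_fin_num _ ih))// lee_fin; exact: ltW.
by rewrite lee_pmul2l in key.
Qed.

Section Geodesic.
Variables (gamma : R -> probability bH R) (C : R).
Hypotheses (C0 : 0 < C) (Wgamma : forall t, Wp p (gamma t)).
Hypothesis cost_gamma : forall s t,
  optimal_cost p (gamma s) (gamma t) = ((C * `|t - s|) `^ p)%:E.

Let m t := hmean (gamma t).

Lemma hmean_arithmetic (s tau : R) (k : nat) : 0 < tau ->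
  m (s + k%:R * tau) - m s = k%:R *: (m (s + tau) - m s).
Proof.
move=> tau0.
have step x : m (x + tau) - m x = m (x + tau + tau) - m (x + tau).
  apply: (hmean_midpoint p1 C0 tau0) => //; rewrite cost_gamma.
  - by rewrite (addrC x) addrK gtr0_norm.
  - by rewrite (addrC (x + tau)) addrK gtr0_norm.
  - rewrite (_ : x + tau + tau - x = 2 * tau); last by ring.
    by rewrite gtr0_norm ?mulr_gt0// mulrCA.
have inc j : m (s + j%:R * tau + tau) - m (s + j%:R * tau) = m (s + tau) - m s.
  elim: j => [|j IH]; first by rewrite mul0r addr0.
  by rewrite -natr1 mulrDl mul1r addrA -step.
elim: k => [|k IH]; first by rewrite mul0r addr0 subrr scale0r.
rewrite -natr1 scalerDl scale1r -IH -(inc k) mulrDl mul1r addrA.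
by rewrite [RHS]addrC addrA subrK.
Qed.

(** The means are equally spaced, so their speed over long times is their speed
    at every scale. *)
Lemma hmean_speed (s tau : R) : 0 < tau -> C * tau <= enorm (m (s + tau) - m s).
Proof.
move=> tau0; apply/ler_addgt0Pr => z z0.
have zt0 : 0 < z / tau by rewrite divr_gt0.
have [T0 hT0] := hmean_growth p1 C0 zt0 (Wgamma s).
pose k := (Num.truncn `|T0 / tau|).+1.
have k0 : 0 < k%:R :> R by rewrite ltr0n.
have T0k : T0 <= k%:R * tau.
  rewrite -ler_pdivrMr//; apply: le_trans (ler_norm _) _.
  by rewrite ltW// truncnS_gt.
have kt0 : 0 < k%:R * tau by rewrite mulr_gt0.
have := hT0 (k%:R * tau) (gamma (s - k%:R * tau)) (gamma (s + k%:R * tau))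
  T0k kt0 (Wgamma _) (Wgamma _).
rewrite !cost_gamma -/(m s) -/(m _) hmean_arithmetic// enormZ (gtr0_norm k0).
have -> : s - (s - k%:R * tau) = k%:R * tau by ring.
have -> : s + k%:R * tau - s = k%:R * tau by ring.
have -> : s + k%:R * tau - (s - k%:R * tau) = 2 * (k%:R * tau) by ring.
rewrite !gtr0_norm ?mulr_gt0// => /(_ erefl erefl).
rewrite (mulrCA C 2) => /(_ erefl).
have -> : C * (k%:R * tau) = k%:R * (C * tau) by ring.
have -> : z / tau * (k%:R * tau) = k%:R * z by field; rewrite gt_eqF.
by rewrite -mulrDr ler_pM2l.
Qed.

Lemma hmean_isometric (s t : R) : enorm (m t - m s) = C * `|t - s|.
Proof.
apply/eqP; rewrite eq_le; apply/andP; split.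
  have := optimal_cost_ge p1 (Wgamma s) (Wgamma t).
  rewrite cost_gamma lee_fin -/(m t) -/(m s) => le.
  rewrite leNgt; apply/negP => lt; move: le; rewrite leNgt => /negP; apply.
  apply: gt0_ltr_powR; rewrite ?nnegrE ?enorm_ge0//.
  by apply: mulr_ge0 => //; exact: ltW.
have [st|ts|->] := ltgtP s t.
- rewrite gtr0_norm ?subr_gt0//.
  have := @hmean_speed s (t - s); rewrite subr_gt0 (addrC s) subrK; exact.
- rewrite distrC enormBC gtr0_norm ?subr_gt0//.
  have := @hmean_speed t (s - t); rewrite subr_gt0 (addrC t) subrK; exact.
- by rewrite subrr normr0 mulr0 enorm_ge0.
Qed.

(** An isometric copy of the line in a Euclidean space is a straight line, by
    polarisation. *)
Lemma hmean_affine (t : R) : m t - m 0 = t *: (m 1 - m 0).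
Proof.
apply/eqP; rewrite -subr_eq0; apply/eqP/enorm0_eq0/eqP.
rewrite -sqrf_eq0 enormB_sq enormZ exprMn real_normK ?num_real//.
rewrite dotZr.
have e0 := hmean_isometric 0 t; have e1 := hmean_isometric 0 1.
have e2 := hmean_isometric 1 t.
have := enormB_sq (m t - m 0) (m 1 - m 0).
rewrite (_ : m t - m 0 - (m 1 - m 0) = m t - m 1); last first.
  by rewrite opprB addrA subrK.
rewrite e0 e1 e2 !exprMn !real_normK ?num_real// !subr0 expr1n mulr1 => h.
have -> : dot (m t - m 0) (m 1 - m 0) = C ^+ 2 * t by lra.
by apply/eqP; ring.
Qed.

Lemma geodesic_translate (t : R) : let W := m 1 - m 0 in
  eq_meas (gamma t)
    (translate (gamma 0) (t *: lsubmx W) (t *: rsubmx W)).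
Proof.
move=> W; have [->|t0] := eqVneq t 0.
  move=> A _; congr (gamma 0 _); apply/seteqP.
  by split => q; rewrite /= /right_translation !scale0r heis_mul0.
have tWE : row_mx (t *: lsubmx W) (t *: rsubmx W) = m t - m 0.
  by rewrite -scale_row_mx hsubmxK hmean_affine.
have lE : enorm (row_mx (t *: lsubmx W) (t *: rsubmx W)) = C * `|t - 0|.
  by rewrite tWE hmean_isometric.
have l0 : 0 < enorm (row_mx (t *: lsubmx W) (t *: rsubmx W)).
  by rewrite lE subr0 mulr_gt0// normr_gt0.
move=> A mA; apply: esym.
apply: (translate_of_optimal (Wgamma 0) (Wgamma t) tWE l0) => //.
by rewrite lE cost_gamma.
Qed.

End Geodesic.
End Rigidity.

(** * Optimality of translations and complete geodesics *)

Theorem proposition3p3 (R : realType) (n : nat) (p : R)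
    (hn : (1 <= n)%N) (hp : 1 < p) :
  (forall (u v : 'rV[R]_n) (t : R) (nu : probability (borel (heis R n)) R),
     Wp p nu ->
     optimal_transport_map p nu
       (right_translation (horizontal (t *: u) (t *: v)))) /\
  (forall gamma : R -> probability (borel (heis R n)) R,
     (forall t, Wp p (gamma t)) ->
     (complete_geodesic p gamma <->
      exists (mu : probability (borel (heis R n)) R) (u v : 'rV[R]_n),
        [/\ Wp p mu,
            horizontal u v <> horizontal 0 0 &
            forall t, eq_meas (gamma t)
              (distribution mu
                 (right_translation (horizontal (t *: u) (t *: v))))])).
Proof.
have p0 : 0 < p by exact: lt_trans ltr01 hp.
split=> [u v t nu Wnu|gamma Wgamma]; first exact: translate_optimal.
split=> [[_ [C C0 dC]]|[mu [u [v [Wmu U0 gammaE]]]]].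
  have cost_gamma s t : optimal_cost p (gamma s) (gamma t) =
      ((C * `|t - s|) `^ p)%:E.
    apply/(dWp_eq hp); first by apply: mulr_ge0 => //; exact: ltW.
    by rewrite dC distrC.
  pose W := hmean (gamma 1) - hmean (gamma 0).
  exists (gamma 0), (lsubmx W), (rsubmx W); split=> //; last first.
    by move=> t; exact: (geodesic_translate hp C0 Wgamma cost_gamma t).
  move=> [l0 r0]; have := hmean_isometric hp C0 Wgamma cost_gamma 0 1.
  rewrite -/W -(hsubmxK W) l0 r0 row_mx0 subr0 normr1 mulr1 => C00.
  move: C0; rewrite -C00 /enorm /dot big1 ?sqrtr0 ?ltxx// => i _.
  by rewrite mxE mul0r.
split=> //; exists (enorm (row_mx u v)).
  rewrite lt_neqAle enorm_ge0 andbT eq_sym; apply/eqP => /enorm0_eq0 uv0.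
  apply: U0; congr horizontal.
    by rewrite -(row_mxKl u v) uv0 linear0.
  by rewrite -(row_mxKr u v) uv0 linear0.
move=> t s; apply/(dWp_eq hp); first by apply: mulr_ge0; [exact: enorm_ge0|].
pose nu : probability (borel (heis R n)) R :=
  distribution mu (right_translation (horizontal (t *: u) (t *: v))).
have Wnu : Wp p nu by exact: Wp_translate.
rewrite (optimal_cost_eq p (mu' := nu) (nu' := distribution nu
    (right_translation (horizontal ((s - t) *: u) ((s - t) *: v))))).
- rewrite optimal_cost_translate// -scale_row_mx enormZ.
  by rewrite distrC (mulrC `|_|).
- exact: gammaE.
- move=> A mA; rewrite gammaE//; congr (mu _); apply/seteqP.
  by split => q; rewrite /= /right_translation heis_mul_horizontal.
Qed.
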